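(* Let $U=U^{AE\to BF}$ be a two-qubit unitary of the form $U_{\boldsymbol\alpha}$, $\boldsymbol\alpha=(\alpha_x,\alpha_y,\alpha_z)$ with $\frac{\pi}{2}\ge\alpha_x\ge\alpha_y\ge\alpha_z\ge 0$ (see context), let $\boldsymbol\phi$ be a fixed qubit state of $A$ (the probe state), and let $\mathcal N_{\boldsymbol\phi}^{E\to B}(\boldsymbol\theta)=\mathrm{Tr}_F\big(U(\boldsymbol\phi\otimes\boldsymbol\theta)U^\dagger\big)$ for states $\boldsymbol\theta$ of $E$. Then for a given $\epsilon>0$ and every number $n$ of channel uses, $$Q^{\epsilon,n}\big(\mathcal N_{\boldsymbol\phi}^{E\to B}\big):=\frac1n\,Q^{\epsilon}\big((\mathcal N_{\boldsymbol\phi}^{E\to B})^{\otimes n}\big)\;\ge\;\sup_{\delta\in(0,\sqrt{\epsilon/2})}\Big[\mathbb H_2(B|F)_\rho-\frac1n\Big(g\big(\sqrt{\epsilon/2}-\delta\big)+4\log_2\frac1\delta+2\Big)\Big]$$ $$=\;\mathbb H_2(B|F)_\rho-\frac1n\Big(g\big(\sqrt{\epsilon/2}-\delta_\star\big)+4\log_2\frac1{\delta_\star}+2\Big),$$ where $\delta_\star$ is the value of $\delta$ minimizing $g(\sqrt{\epsilon/2}-\delta)-4\log_2\delta$ within the interval $(0,\sqrt{\epsilon/2})$.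
   Context: All systems $A,B,E,F$ are qubits, $A\simeq B$, $E\simeq F$. In the basis $\{|0\rangle_A|0\rangle_E,|0\rangle_A|1\rangle_E,|1\rangle_A|0\rangle_E,|1\rangle_A|1\rangle_E\}$ (the output factors are $B$ first, $F$ second), $$U_{\boldsymbol\alpha}=\begin{pmatrix}\cos\frac{\alpha_x-\alpha_y}{2}&0&0&-i\sin\frac{\alpha_x-\alpha_y}{2}\\0&e^{i\alpha_z}\cos\frac{\alpha_x+\alpha_y}{2}&-ie^{i\alpha_z}\sin\frac{\alpha_x+\alpha_y}{2}&0\\0&-ie^{i\alpha_z}\sin\frac{\alpha_x+\alpha_y}{2}&e^{i\alpha_z}\cos\frac{\alpha_x+\alpha_y}{2}&0\\-i\sin\frac{\alpha_x-\alpha_y}{2}&0&0&\cos\frac{\alpha_x-\alpha_y}{2}\end{pmatrix}.$$ The complementary channel of $\mathcal N_{\boldsymbol\phi}^{E\to B}$ is taken to be $(\mathcal N_{\boldsymbol\phi}^{E\to B})^c(\boldsymbol\theta)=\mathrm{Tr}_B\big(U(\boldsymbol\phi\otimes\boldsymbol\theta)U^\dagger\big)$, with output $F$. The state $\rho=\rho_{BF}$ is $\rho_{BF}:=(\mathrm{id}^{A\to B}\otimes(\mathcal N_{\boldsymbol\phi}^{E\to B})^c)(\Phi_{AE})$, where $\Phi_{AE}$ is a maximally entangled state of two qubits $A$ and $E$; here the first qubit is an untouched reference, relabelled $B$. One-shot quantum capacity: $$Q^\epsilon\big((\mathcal N_{\boldsymbol\phi}^{E\to B})^{\otimes n}\big)=\max\big\{\log_2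 m : F_{\min}\big((\mathcal N_{\boldsymbol\phi}^{E\to B})^{\otimes n},m\big)\ge 1-\epsilon\big\},$$ $$F_{\min}\big((\mathcal N_{\boldsymbol\phi}^{E\to B})^{\otimes n},m\big)=\max_{\mathcal H'_E\subset\mathcal H_E^{\otimes n},\,\dim\mathcal H'_E=m}\ \max_{\mathcal D}\ \min_{|\omega\rangle\in\mathcal H'_E}\langle\omega|\big(\mathcal D\circ(\mathcal N_{\boldsymbol\phi}^{E\to B})^{\otimes n}\big)(\omega)|\omega\rangle,$$ where $|\omega\rangle$ ranges over (unit) state vectors, $\omega=|\omega\rangle\langle\omega|$, and $\mathcal D$ ranges over decoding maps (quantum channels) from $\mathcal H_B^{\otimes n}\simeq\mathcal H_E^{\otimes n}$ to $\mathcal H'_B\simeq\mathcal H'_E$. Conditional Rényi entropy of order 2: $\mathbb H_2(B|F)_\rho:=\max_{\sigma_F}\big(-D_2(\rho_{BF}\Vert I_B\otimes\sigma_F)\big)$, the maximum being over states $\sigma_F$ of $F$, with $$D_2(\rho_{BF}\Vert I_B\otimes\sigma_F)=\log_2\mathrm{Tr}\big\{[(I_B\otimes\sigma_F)^{-1/4}\rho_{BF}(I_B\otimes\sigma_F)^{-1/4}]^2\big\}.$$ The function $g$ is $g(x):=-\log_2\big(1-\sqrt{1-x^2}\big)$.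
   Formalization: The probe state φ is taken pure (for mixed φ the claim fails: α=(π/2,π/2,0), φ=I/2 gives a dephasing channel, yet H_2(B|F)=1), and ε≤2 is assumed, since otherwise g(√(ε/2)−δ) is undefined for small δ. *)

(* Defs.v *)
From HB Require Import structures.
From mathcomp Require Import all_boot all_order all_algebra.
From mathcomp Require Import sesquilinear spectral.
From mathcomp Require Import all_classical all_reals all_analysis.
From mathcomp Require Import complex mxtens.

Set Implicit Arguments.
Unset Strict Implicit.
Unset Printing Implicit Defensive.

Import Order.TTheory GRing.Theory Num.Theory.
Import numFieldNormedType.Exports.

Local Open Scope classical_set_scope.
Local Open Scope ring_scope.
Local Open Scope complex_scope.
Local Open Scope sesquilinear_scope.

(* The basis of a tensor product C^p (x) C^q is ordered lexicographically:
   |i>|j> has index [mxtens_index (i, j)], whose value is i * q + j. *)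

Section States.
Variable R : realType.
Local Notation C := R[i].

(* In R[i], 0 <= z says that z is real and nonnegative; so this condition
   forces A to be Hermitian. *)
Definition psdmx p (A : 'M[C]_p) : Prop :=
  forall v : 'cV[C]_p, 0 <= (v^t* *m A *m v) 0 0.

Definition unit_vector p (v : 'cV[C]_p) : Prop := (v^t* *m v) 0 0 = 1.

Definition ketbra p (v : 'cV[C]_p) : 'M[C]_p := v *m v^t*.

Definition is_state p (A : 'M[C]_p) : Prop := psdmx A /\ \tr A = 1.

Definition pure_state p (A : 'M[C]_p) : Prop :=
  exists2 v : 'cV[C]_p, unit_vector v & A = ketbra v.

(* Trace over the first, resp. the second, tensor factor. *)
Definition ptrace1 p q (X : 'M[C]_(p * q)) : 'M[C]_q :=
  \matrix_(i, j) \sum_(k < p) X (mxtens_index (k, i)) (mxtens_index (k, j)).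

Definition ptrace2 p q (X : 'M[C]_(p * q)) : 'M[C]_p :=
  \matrix_(i, j) \sum_(k < q) X (mxtens_index (i, k)) (mxtens_index (j, k)).

Definition max_entangled d (Phi : 'M[C]_(d * d)) : Prop :=
  [/\ pure_state Phi, ptrace1 Phi = (d%:R^-1)%:M & ptrace2 Phi = (d%:R^-1)%:M].

End States.

Section Channels.
Variable R : realType.
Local Notation C := R[i].

(* The tensor product of two linear maps f and g: the linear map sending
   |i><j| (x) |k><l| to f(|i><j|) (x) g(|k><l|). *)
Definition tens_map p p' q q' (f : 'M[C]_p -> 'M[C]_p')
    (g : 'M[C]_q -> 'M[C]_q') (X : 'M[C]_(p * q)) : 'M[C]_(p' * q') :=
  \sum_(i < p) \sum_(j < p) \sum_(k < q) \sum_(l < q)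
    X (mxtens_index (i, k)) (mxtens_index (j, l)) *:
      (f (delta_mx i j) *t g (delta_mx k l)).

(* Completely positive trace-preserving linear maps. *)
Record is_channel p q (f : 'M[C]_p -> 'M[C]_q) : Prop := IsChannel {
  channel_linear : linear f;
  channel_cp : forall k (X : 'M[C]_(k * p)),
    psdmx X -> psdmx (tens_map (@id 'M[C]_k) f X);
  channel_tp : forall X : 'M[C]_p, \tr (f X) = \tr X }.

(* d ^ n, in a form for which [dimpow d n.+1] is convertible to
   [d * dimpow d n]. *)
Fixpoint dimpow (d n : nat) : nat :=
  if n is n'.+1 then (d * dimpow d n')%N else 1%N.

Lemma dimpowE d n : dimpow d n = (d ^ n)%N.
Proof. by elim: n => [|n IHn] //=; rewrite IHn expnS. Qed.

(* The n-fold tensor power of a channel. *)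
Fixpoint channel_pow d (f : 'M[C]_d -> 'M[C]_d) (n : nat) :
    'M[C]_(dimpow d n) -> 'M[C]_(dimpow d n) :=
  match n with
  | 0 => id
  | n'.+1 => tens_map f (@channel_pow d f n')
  end.

End Channels.

Section Entropies.
Variable R : realType.
Local Notation C := R[i].

Definition log2 (x : R) : R := ln x / ln 2.

(* A ^ r for A positive semidefinite and r <> 0, by functional calculus.  Since
   0 `^ r = 0 for r <> 0, the kernel of A is sent to 0; thus for r < 0 this is
   the power taken on the support of A. *)
Definition mxpower p (A : 'M[C]_p) (r : R) : 'M[C]_p :=
  invmx (spectralmx A)
    *m diag_mx (map_mx (fun l : C => (complex.Re l `^ r)%:C) (spectral_diag A))
    *m spectralmx A.

(* The order-2 sandwiched Renyi divergence, equal to +oo unless the support of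
   rho is contained in that of tau: for Hermitian matrices, this inclusion is
   the inclusion of the row spaces. *)
Definition D2 p (rho tau : 'M[C]_p) : \bar R :=
  if (rho <= tau)%MS then
    let t := mxpower tau (- 4^-1) in
    let M := t *m rho *m t in
    (log2 (complex.Re (\tr (M *m M))))%:E
  else +oo%E.

(* H_2(B|F)_rho for rho = rho_BF with B of dimension p and F of dimension q. *)
Definition H2 p q (rho : 'M[C]_(p * q)) : \bar R :=
  ereal_sup [set (- D2 rho ((1%:M : 'M[C]_p) *t sigma))%E |
    sigma in [set sigma : 'M[C]_q | is_state sigma]].

Definition gfun (x : R) : R := - log2 (1 - Num.sqrt (1 - x ^+ 2)).

End Entropies.

Section Capacity.
Variable R : realType.
Local Notation C := R[i].

(* The fidelity <w| X |w>. *)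
Definition fidelity p (w : 'cV[C]_p) (X : 'M[C]_p) : R :=
  complex.Re ((w^t* *m X *m w) 0 0).

(* A decoder for the code space H is a channel whose outputs are operators on
   H, seen as operators on C^p with range in H. *)
Definition is_decoder p (H : {vspace 'cV[C]_p}) (D : 'M[C]_p -> 'M[C]_p) : Prop :=
  is_channel D /\ forall (X : 'M[C]_p) (u : 'cV[C]_p), D X *m u \in H.

Definition min_fidelity p (T : 'M[C]_p -> 'M[C]_p) (m : nat) : R :=
  sup [set sup [set inf [set fidelity w (D (T (ketbra w))) |
                    w in [set w : 'cV[C]_p | w \in H /\ unit_vector w]] |
              D in [set D | is_decoder H D]] |
        H in [set H : {vspace 'cV[C]_p} | \dim H = m]].

(* The bounds on m say that nonzero subspaces of dimension m exist; outside of
   them the extrema defining [min_fidelity] range over empty sets. *)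
Definition one_shot_capacity p (eps : R) (T : 'M[C]_p -> 'M[C]_p) : R :=
  sup [set log2 m%:R |
    m in [set m : nat | (0 < m <= p)%N /\ 1 - eps <= min_fidelity T m]].

End Capacity.

Section Interaction.
Variable R : realType.
Local Notation C := R[i].

Definition expi (t : R) : C := cos t +i* sin t.

Definition Ualpha (ax ay az : R) : 'M[C]_(2 * 2) :=
  let cm := (cos ((ax - ay) / 2))%:C in
  let sm := 0 -i* sin ((ax - ay) / 2) in
  let cp := expi az * (cos ((ax + ay) / 2))%:C in
  let sp := expi az * (0 -i* sin ((ax + ay) / 2)) in
  \matrix_(i, j) nth 0 (nth [::]
    [:: [:: cm;  0;  0; sm];
        [::  0; cp; sp;  0];
        [::  0; sp; cp;  0];
        [:: sm;  0;  0; cm]] i) j.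

(* U maps A (x) E to B (x) F. *)
Definition evolve (U : 'M[C]_(2 * 2)) (phi theta : 'M[C]_2) : 'M[C]_(2 * 2) :=
  U *m (phi *t theta) *m U^t*.

Definition Nchan (U : 'M[C]_(2 * 2)) (phi theta : 'M[C]_2) : 'M[C]_2 :=
  ptrace2 (evolve U phi theta).

Definition Ncompl (U : 'M[C]_(2 * 2)) (phi theta : 'M[C]_2) : 'M[C]_2 :=
  ptrace1 (evolve U phi theta).

(* Phi is a state of A (x) E; A is relabelled B. *)
Definition rhoBF (U : 'M[C]_(2 * 2)) (phi : 'M[C]_2) (Phi : 'M[C]_(2 * 2)) :
    'M[C]_(2 * 2) :=
  tens_map (@id 'M[C]_2) (Ncompl U phi) Phi.

End Interaction.

Definition is_argmin_on (R : realType) (I : set R) (f : R -> R) (x : R) : Prop :=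
  I x /\ forall y, I y -> f x <= f y.

(* Main.v *)
(* Let A_k be the Kraus operators of the n-fold channel in an eigenbasis of a state
   sigma_F^(x)n with eigenvalues r_k ^ 2, and d = 2 ^ n.  Then 2 ^ (n D_2) is
   d ^ -2 times the sum over k, l of (r_k r_l) ^ -1 |A_k^* A_l|^2, in Hilbert-Schmidt
   norm.  The columns of diag(signs) * Hadamard, cut down to a random subset of size
   2m, span a code W for which the blocks W^* A_k^* A_l W of the Gram matrix G of
   (A_k W)_k are on average close to multiples omega_kl of the identity.  The
   decoder is the polar isometry G^(-1/2) (A_k W)_k^*; by a weighted
   Powers-Stormer inequality the distance of sqrt G to sqrt omega (x) 1 bounds
   its average infidelity, and half of the dimensions are discarded to bound the
   worst case.  This gives infidelity eps as soon as 128 m 2 ^ (n D_2) <= eps ^ 2,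
   which leaves room for the constants of the theorem because
   2 ^ -g(x) <= x ^ 2 and x + delta = sqrt (eps / 2).  All averages are over finite
   sets, so neither Haar measure nor Uhlmann's theorem is needed. *)

Require Import Defs.
From HB Require Import structures.
From mathcomp Require Import all_boot all_order all_algebra.
From mathcomp Require Import fingroup perm sesquilinear spectral.
From mathcomp Require Import all_classical all_reals all_analysis.
From mathcomp Require Import complex mxtens.
From mathcomp Require Import zify ring lra.

Set Implicit Arguments.
Unset Strict Implicit.
Unset Printing Implicit Defensive.

Import Order.TTheory GRing.Theory Num.Theory.
Import numFieldNormedType.Exports.

Local Open Scope classical_set_scope.
Local Open Scope ring_scope.

(** * Adjoints and positive matrices *)

Section Adjoint.
Variable C : numClosedFieldType.
Local Open Scope sesquilinear_scope.

(** A subset of q basis vectors keeps an off-diagonal entry of an operator X with probability about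
    (q/d)^2, but a diagonal entry with probability q/d. This is why two sources of randomness are
    combined: the signs first bring the squared diagonal of a traceless X down to 2 |X|^2 / d on
    average, after which the subset treats both parts at the scale (q/d)^2 |X|^2. Subtracting from
    A_k^* A_l its scalar part provides the zero trace. The plain Powers-Stormer bound in trace norm,
    followed by Cauchy-Schwarz, would bring in the number 2^n of Kraus operators. The weights avoid
    this: the r_k^2 sum to 1, so that AM-GM against a unitary costs only q, whatever the number of
    operators. H_2 is a supremum over sigma_F while the capacity does not involve sigma_F, so each
    sigma_F gets its own code. On product states the weighted sum over k, l is exactly
    multiplicative, which makes the rate n D_2 exact. *)

Lemma adjmxE m n (A : 'M[C]_(m, n)) i j : A^t* i j = (A j i)^*.
Proof. by rewrite !mxE. Qed.

Lemma adjmxM m n p (A : 'M[C]_(m, n)) (B : 'M[C]_(n, p)) :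
  (A *m B)^t* = B^t* *m A^t*.
Proof. by rewrite trmx_mul map_mxM. Qed.

Lemma adjmxD m n (A B : 'M[C]_(m, n)) : (A + B)^t* = A^t* + B^t*.
Proof. by apply/matrixP => i j; rewrite !mxE rmorphD. Qed.

Lemma adjmxB m n (A B : 'M[C]_(m, n)) : (A - B)^t* = A^t* - B^t*.
Proof. by apply/matrixP => i j; rewrite !mxE rmorphB. Qed.

Lemma adjmxZ m n (a : C) (A : 'M[C]_(m, n)) : (a *: A)^t* = a^* *: A^t*.
Proof. by apply/matrixP => i j; rewrite !mxE rmorphM. Qed.

Lemma adjmx_scalar n (a : C) : (a%:M : 'M[C]_n)^t* = (a^*)%:M.
Proof. by apply/matrixP => i j; rewrite !mxE rmorphMn eq_sym. Qed.

Lemma adjmx1 n : (1%:M : 'M[C]_n)^t* = 1%:M.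
Proof. by rewrite adjmx_scalar rmorph1. Qed.

Lemma adjmx_delta m n (i : 'I_m) (j : 'I_n) :
  (delta_mx i j : 'M[C]_(m, n))^t* = delta_mx j i.
Proof. by apply/matrixP => a b; rewrite !mxE rmorph_nat andbC. Qed.

Lemma adjmx_tens m n p q (A : 'M[C]_(m, n)) (B : 'M[C]_(p, q)) :
  (A *t B)^t* = A^t* *t B^t*.
Proof. by apply/matrixP => i j; rewrite !mxE rmorphM. Qed.

Lemma adjmx_diag_real n (l : 'rV[C]_n) :
  (forall i, l 0 i \is Num.real) -> (diag_mx l)^t* = diag_mx l.
Proof.
move=> hl; apply/matrixP => i j; rewrite !mxE rmorphMn /= eq_sym.
case: eqVneq => [->|_] /=; last by rewrite !mulr0n.
by rewrite !mulr1n (CrealP (hl _)).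
Qed.

Lemma sum_mxtens_index (V : nmodType) m n (F : 'I_(m * n) -> V) :
  \sum_k F k = \sum_i \sum_j F (mxtens_index (i, j)).
Proof.
rewrite pair_bigA /= (reindex (@mxtens_index m n)) //=.
  by apply: eq_bigr => -[].
by exists (@mxtens_unindex m n) => i _; rewrite (mxtens_indexK, mxtens_unindexK).
Qed.

(** Squared Hilbert-Schmidt norm. It takes values in [C] because it is compared with traces and
    quadratic forms there, where [0 <= z] includes reality. *)
Definition hsnorm2 m n (A : 'M[C]_(m, n)) : C := \sum_i \sum_j `|A i j| ^+ 2.

Lemma hsnorm2_ge0 m n (A : 'M[C]_(m, n)) : 0 <= hsnorm2 A.
Proof. by apply: sumr_ge0 => i _; apply: sumr_ge0 => j _; rewrite exprn_ge0. Qed.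

Lemma hsnorm2_tr m n (A : 'M[C]_(m, n)) : hsnorm2 A = \tr (A^t* *m A).
Proof.
rewrite /hsnorm2 exchange_big; apply: eq_bigr => j _; rewrite mxE.
by apply: eq_bigr => i _; rewrite adjmxE normCKC.
Qed.

Lemma hsnorm2_adj m n (A : 'M[C]_(m, n)) : hsnorm2 (A^t*) = hsnorm2 A.
Proof.
rewrite /hsnorm2 exchange_big; apply: eq_bigr => i _; apply: eq_bigr => j _.
by rewrite adjmxE norm_conjC.
Qed.

Lemma hsnorm2_eq0 m n (A : 'M[C]_(m, n)) : hsnorm2 A = 0 -> A = 0.
Proof.
move=> h; apply/matrixP => i j; rewrite mxE.
have h1 : \sum_j `|A i j| ^+ 2 = 0.
  apply: (psumr_eq0P _ h) => // k _.
  by apply: sumr_ge0 => l _; rewrite exprn_ge0.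
have /eqP : `|A i j| ^+ 2 = 0.
  by apply: (psumr_eq0P _ h1) => // k _; rewrite exprn_ge0.
by rewrite expf_eq0 normr_eq0 => /eqP.
Qed.

Lemma hsnorm2_isometryl m n p (W : 'M[C]_(p, m)) (A : 'M[C]_(m, n)) :
  W^t* *m W = 1%:M -> hsnorm2 (W *m A) = hsnorm2 A.
Proof.
by move=> hW; rewrite !hsnorm2_tr adjmxM mulmxA -(mulmxA _ _ W) hW mulmx1.
Qed.

Lemma hsnorm2_coisometryr m n p (W : 'M[C]_(n, p)) (A : 'M[C]_(m, n)) :
  W *m W^t* = 1%:M -> hsnorm2 (A *m W) = hsnorm2 A.
Proof.
move=> hW; rewrite -hsnorm2_adj adjmxM hsnorm2_isometryl ?hsnorm2_adj //.
by rewrite trmxCK.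
Qed.

Lemma quad_hsnorm2 m n (A : 'M[C]_(m, n)) (v : 'cV_n) :
  (v^t* *m (A^t* *m A) *m v) 0 0 = hsnorm2 (A *m v).
Proof.
by rewrite hsnorm2_tr trace_mx11 adjmxM !mulmxA.
Qed.

Lemma sqnormv m (v : 'cV[C]_m) : (v^t* *m v) 0 0 = hsnorm2 v.
Proof. by rewrite hsnorm2_tr trace_mx11. Qed.

Lemma hsnorm2Z m n (a : C) (A : 'M[C]_(m, n)) :
  hsnorm2 (a *: A) = `|a| ^+ 2 * hsnorm2 A.
Proof.
rewrite /hsnorm2 mulr_sumr; apply: eq_bigr => i _; rewrite mulr_sumr.
by apply: eq_bigr => j _; rewrite mxE normrM exprMn.
Qed.

End Adjoint.

Section Positive.
Variable C : numClosedFieldType.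
Local Open Scope sesquilinear_scope.

(* Convertible to [psdmx] for [C = R[i]]. *)
Definition psd n (A : 'M[C]_n) : Prop :=
  forall v : 'cV[C]_n, 0 <= (v^t* *m A *m v) 0 0.

Lemma quadE n (A : 'M[C]_n) (v : 'cV[C]_n) :
  (v^t* *m A *m v) 0 0 = \sum_i \sum_j (v i 0)^* * A i j * v j 0.
Proof.
rewrite mxE exchange_big; apply: eq_bigr => j _; rewrite mxE mulr_suml.
by apply: eq_bigr => i _; rewrite adjmxE.
Qed.

Lemma psd_gram m n (Z : 'M[C]_(m, n)) : psd (Z^t* *m Z).
Proof. by move=> v; rewrite quad_hsnorm2 hsnorm2_ge0. Qed.

Lemma psd_congr m n (Z : 'M[C]_(m, n)) (A : 'M[C]_m) :
  psd A -> psd (Z^t* *m A *m Z).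
Proof. by move=> hA v; have := hA (Z *m v); rewrite adjmxM !mulmxA. Qed.

Lemma psdD n (A B : 'M[C]_n) : psd A -> psd B -> psd (A + B).
Proof.
by move=> hA hB v; rewrite mulmxDr mulmxDl mxE addr_ge0.
Qed.

Lemma psd_sum n (I : finType) (F : I -> 'M[C]_n) :
  (forall i, psd (F i)) -> psd (\sum_i F i).
Proof.
move=> hF; elim/big_ind: _ => //; last exact: psdD.
by move=> v; rewrite mulmx0 mul0mx mxE.
Qed.

Lemma quad_delta n (A : 'M[C]_n) i :
  (((delta_mx i 0 : 'cV[C]_n)^t*) *m A *m (delta_mx i 0 : 'cV_n)) 0 0 = A i i.
Proof.
by rewrite adjmx_delta -rowE -colE !mxE.
Qed.

Lemma psd_diag_ge0 n (A : 'M[C]_n) i : psd A -> 0 <= A i i.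
Proof. by move=> hA; rewrite -quad_delta. Qed.

(* Polarization, with the vectors [e_i + a e_j] for [a = 1, 'i]. *)
Lemma quad_eq0 n (X : 'M[C]_n) :
  (forall v : 'cV[C]_n, (v^t* *m X *m v) 0 0 = 0) -> X = 0.
Proof.
move=> h; apply/matrixP => i j; rewrite mxE.
have d k : X k k = 0 by rewrite -quad_delta.
have key (a : C) : a * X i j + a^* * X j i = 0.
  have := h (delta_mx i 0 + a *: delta_mx j 0).
  rewrite adjmxD adjmxZ !adjmx_delta !mulmxDl !mulmxDr -!scalemxAl -!scalemxAr.
  rewrite -!rowE -!colE !mxE !d.
  by rewrite !(mulr0, addr0, add0r) addrC.
have := key 1; rewrite rmorph1 !mul1r => /eqP; rewrite addr_eq0 => /eqP e1.
have := key 'i; rewrite conjCi e1 mulrN mulNr -opprD -mulr2n => /eqP.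
rewrite oppr_eq0 mulrn_eq0 /= mulf_eq0 (negbTE (neq0Ci _)) => /eqP e2.
by rewrite e2 oppr0.
Qed.

(** A nonnegative quadratic form is real, so [A^t*] and [A] have the same one, and [quad_eq0]
    applies to their difference. *)
Lemma psd_adj n (A : 'M[C]_n) : psd A -> A^t* = A.
Proof.
move=> hA; apply/eqP; rewrite -subr_eq0; apply/eqP/quad_eq0 => v.
rewrite mulmxBr mulmxBl mxE [X in _ + X]mxE.
apply/eqP; rewrite subr_eq0; apply/eqP.
have /ger0_real/CrealP <- := hA v.
by rewrite -(adjmxE (v^t* *m A *m v)) !adjmxM trmxCK !mulmxA.
Qed.

Lemma herm_spectral n (A : 'M[C]_n) : A^t* = A ->
  exists U : 'M[C]_n, exists l : 'rV[C]_n,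
  [/\ U *m U^t* = 1%:M, U^t* *m U = 1%:M, forall i, l 0 i \is Num.real &
      A = U^t* *m diag_mx l *m U].
Proof.
move=> hA; have hh : A \is hermsymmx.
  by apply/is_hermitianmxP; rewrite expr0 scale1r hA.
have uU := spectral_unitarymx A.
exists (spectralmx A), (spectral_diag A); split.
- exact/unitarymxP.
- by apply: mulmx1C; exact/unitarymxP.
- by move=> i; have /mxOverP := hermitian_spectral_diag_real hh; apply.
- by rewrite -invmx_unitary //; apply/orthomx_spectralP/hermitian_normalmx.
Qed.

Lemma diag_conj_unitary n (U A : 'M[C]_n) (l : 'rV[C]_n) :
  U *m U^t* = 1%:M -> A = U^t* *m diag_mx l *m U -> U *m A *m U^t* = diag_mx l.
Proof. by move=> hU ->; rewrite !mulmxA hU mul1mx -mulmxA hU mulmx1. Qed.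

Lemma psd_spectral n (A : 'M[C]_n) : psd A ->
  exists U : 'M[C]_n, exists l : 'rV[C]_n,
  [/\ U *m U^t* = 1%:M, U^t* *m U = 1%:M, forall i, 0 <= l 0 i &
      A = U^t* *m diag_mx l *m U].
Proof.
move=> hA; have [U [l [h1 h2 _ h4]]] := herm_spectral (psd_adj hA).
exists U, l; split => // i.
have := psd_congr (U^t*) hA; rewrite trmxCK (diag_conj_unitary h1 h4).
by move/(psd_diag_ge0 i); rewrite mxE eqxx mulr1n.
Qed.

Lemma conj_diagM n (U : 'M[C]_n) (a b : 'rV[C]_n) : U *m U^t* = 1%:M ->
  (U^t* *m diag_mx a *m U) *m (U^t* *m diag_mx b *m U) =
  U^t* *m diag_mx (\row_i (a 0 i * b 0 i)) *m U.
Proof.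
move=> hU; rewrite !mulmxA -[_ *m U *m U^t*]mulmxA hU mulmx1.
by rewrite -[_ *m diag_mx a *m _]mulmxA mulmx_diag.
Qed.

Lemma adj_conj_diag n (U : 'M[C]_n) (a : 'rV[C]_n) :
  (forall i, a 0 i \is Num.real) ->
  (U^t* *m diag_mx a *m U)^t* = U^t* *m diag_mx a *m U.
Proof. by move=> ha; rewrite !adjmxM trmxCK adjmx_diag_real // mulmxA. Qed.

Lemma psd_conj_diag n (U : 'M[C]_n) (a : 'rV[C]_n) :
  (forall i, 0 <= a 0 i) -> psd (U^t* *m diag_mx a *m U).
Proof.
move=> ha; apply: psd_congr => v; rewrite quadE sumr_ge0 // => i _.
rewrite sumr_ge0 // => j _; rewrite !mxE; case: eqVneq => [<-|_].
  by rewrite mulr1n mulrAC mulr_ge0 // mulrC mul_conjC_ge0.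
by rewrite mulr0n mulr0 mul0r.
Qed.

Lemma psd_sqrt n (A : 'M[C]_n) : psd A -> exists S : 'M[C]_n, psd S /\ S *m S = A.
Proof.
move=> hA; have [U [l [h1 h2 hl ->]]] := psd_spectral hA.
exists (U^t* *m diag_mx (\row_i sqrtC (l 0 i)) *m U); split.
  by apply: psd_conj_diag => i; rewrite mxE sqrtC_ge0.
rewrite conj_diagM //; congr (_ *m diag_mx _ *m _).
by apply/rowP => i; rewrite !mxE -expr2 sqrtCK.
Qed.

Lemma psd_factor n (A : 'M[C]_n) : psd A -> exists Z : 'M[C]_n, A = Z^t* *m Z.
Proof. by move=> /psd_sqrt [Z [/psd_adj hZ <-]]; exists Z; rewrite hZ. Qed.

Lemma psd_tens m n (A : 'M[C]_m) (B : 'M[C]_n) : psd A -> psd B -> psd (A *t B).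
Proof.
move=> /psd_factor[Y ->] /psd_factor[Z ->].
by rewrite -tensmx_mul -adjmx_tens; apply: psd_gram.
Qed.

(** Stated as positivity of the defect, so that [psd_factor] can write the defect as Z^* Z; this is
    how the decoder is later completed to a trace-preserving map. *)
Definition contraction m n (A : 'M[C]_(m, n)) : Prop := psd (1%:M - A^t* *m A).

(** With P the projection [A^t* *m A], one has 1 - P = (1 - P)^* (1 - P). *)
Lemma contraction_idem m n (A : 'M[C]_(m, n)) :
  (A^t* *m A) *m (A^t* *m A) = A^t* *m A -> contraction A.
Proof.
move=> h; rewrite /contraction.
suff -> : 1%:M - A^t* *m A = (1%:M - A^t* *m A)^t* *m (1%:M - A^t* *m A).
  exact: psd_gram.
rewrite adjmxB adjmx1 adjmxM trmxCK mulmxBr mulmx1 mulmxBl mul1mx h.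
by rewrite subrr subr0.
Qed.

Lemma contractionM m n p (A : 'M[C]_(m, n)) (B : 'M[C]_(n, p)) :
  contraction A -> contraction B -> contraction (A *m B).
Proof.
move=> hA hB; rewrite /contraction.
suff -> : 1%:M - (A *m B)^t* *m (A *m B) =
    (1%:M - B^t* *m B) + B^t* *m (1%:M - A^t* *m A) *m B.
  by apply: psdD => //; exact: psd_congr.
by rewrite mulmxBr mulmx1 mulmxBl addrA subrK adjmxM !mulmxA.
Qed.

(* The pseudo-inverse [(sqrtC 0)^-1 = 0] makes [Rm] a partial isometry. *)
Lemma polar m n (B : 'M[C]_(m, n)) :
  exists S : 'M[C]_n, exists Rm : 'M[C]_(n, m),
  [/\ psd S, S *m S = B^t* *m B, Rm *m B = S & contraction Rm].
Proof.
have [U [l [h1 h2 hl hG]]] := psd_spectral (psd_gram B).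
pose s := \row_i sqrtC (l 0 i); pose t := \row_i (sqrtC (l 0 i))^-1.
pose S := U^t* *m diag_mx s *m U; pose T := U^t* *m diag_mx t *m U.
have s0 i : 0 <= s 0 i by rewrite mxE sqrtC_ge0.
have t0 i : 0 <= t 0 i by rewrite mxE invr_ge0 sqrtC_ge0.
have SS : S *m S = B^t* *m B.
  rewrite conj_diagM // hG; congr (_ *m diag_mx _ *m _).
  by apply/rowP => i; rewrite !mxE -expr2 sqrtCK.
have TSS : T *m (S *m S) = S.
  rewrite !conj_diagM //; congr (_ *m diag_mx _ *m _).
  apply/rowP => i; rewrite !mxE.
  have [->|nz] := eqVneq (sqrtC (l 0 i)) 0; first by rewrite !mul0r mulr0.
  by rewrite mulrA mulVf // mul1r.
have TST : T *m (S *m T) = T.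
  rewrite !conj_diagM //; congr (_ *m diag_mx _ *m _).
  apply/rowP => i; rewrite !mxE.
  have [->|nz] := eqVneq (sqrtC (l 0 i)) 0; first by rewrite invr0 !mul0r.
  by rewrite divff // mulr1.
have Tadj : T^t* = T by apply: adj_conj_diag => i; apply: ger0_real.
exists S, (T *m B^t*); split => //.
- exact: psd_conj_diag.
- by rewrite -mulmxA -SS.
(* [Rm^t* *m Rm] is B T^2 B^*. It is a projection because [T] inverts [S] on its support and
   vanishes elsewhere: T S^2 = S and T S T = T. *)
apply: contraction_idem; rewrite adjmxM trmxCK Tadj.
transitivity (B *m (T *m (T *m (S *m S)) *m (T *m T)) *m B^t*).
  by rewrite SS !mulmxA.
by rewrite TSS -(mulmxA T S) (mulmxA S T T) (mulmxA T (S *m T)) TST !mulmxA.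
Qed.

End Positive.

(** * The Powers-Stormer inequality *)

Section Blocks.
Variable C : numClosedFieldType.
Local Open Scope sesquilinear_scope.

(** The column index stands for C^K (x) C^q, with [k] a Kraus label and [a] a position in the code;
    right multiplication by 1 (x) Y then acts block by block. *)
Definition colblk p K q (M : 'M[C]_(p, K * q)) (k : 'I_K) : 'M[C]_(p, q) :=
  \matrix_(i, a) M i (mxtens_index (k, a)).

Definition rowcat p K q (A : 'I_K -> 'M[C]_(p, q)) : 'M[C]_(p, K * q) :=
  \matrix_(i, j) A (mxtens_unindex j).1 i (mxtens_unindex j).2.

Lemma colblk_rowcat p K q (A : 'I_K -> 'M[C]_(p, q)) k : colblk (rowcat A) k = A k.
Proof. by apply/matrixP => i a; rewrite !mxE mxtens_indexK. Qed.

Lemma hsnorm2_colblk p K q (M : 'M[C]_(p, K * q)) :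
  hsnorm2 M = \sum_k hsnorm2 (colblk M k).
Proof.
rewrite /hsnorm2 [RHS]exchange_big; apply: eq_bigr => i _.
rewrite sum_mxtens_index; apply: eq_bigr => k _; apply: eq_bigr => a _.
by rewrite mxE.
Qed.

Lemma colblkMl p n K q (N : 'M[C]_(n, p)) (M : 'M[C]_(p, K * q)) k :
  colblk (N *m M) k = N *m colblk M k.
Proof.
by apply/matrixP => i a; rewrite !mxE; apply: eq_bigr => j _; rewrite mxE.
Qed.

Lemma colblkMr p K q s (M : 'M[C]_(p, K * q)) (Y : 'M[C]_(q, s)) k :
  colblk (M *m (1%:M *t Y)) k = colblk M k *m Y.
Proof.
apply/matrixP => i a; rewrite !mxE sum_mxtens_index (bigD1 k) //=.
rewrite [X in _ + X]big1 ?addr0 => [|l nlk].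
  by apply: eq_bigr => b _; rewrite tensmxE !mxE eqxx mul1r.
by rewrite big1 // => b _; rewrite tensmxE !mxE (negbTE nlk) mul0r mulr0.
Qed.

Lemma sum2_mxtens_index K q (F : 'I_(K * q) -> 'I_(K * q) -> C) :
  \sum_i \sum_j F i j = \sum_k \sum_l \sum_a \sum_b
    F (mxtens_index (k, a)) (mxtens_index (l, b)).
Proof.
rewrite sum_mxtens_index; apply: eq_bigr => k _; rewrite [RHS]exchange_big.
by apply: eq_bigr => a _; rewrite sum_mxtens_index.
Qed.

Lemma tens1mx1 m n : (1%:M : 'M[C]_m) *t (1%:M : 'M[C]_n) = 1%:M.
Proof.
apply/matrixP => i j; case: (mxtens_indexP i) => a b; case: (mxtens_indexP j) => c e.
rewrite tensmxE !mxE (can_eq (@mxtens_indexK m n)) xpair_eqE.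
by do 2 case: eqVneq => //=; rewrite ?mulr1 ?mulr0 ?mul0r.
Qed.

End Blocks.

Section PowersStormer.
Variable C : numClosedFieldType.
Local Open Scope sesquilinear_scope.

Lemma tr_conj_unitary n (U A : 'M[C]_n) :
  U *m U^t* = 1%:M -> \tr (U^t* *m A *m U) = \tr A.
Proof. by move=> hU; rewrite mxtrace_mulC mulmxA hU mul1mx. Qed.

Lemma tr_mul_diag n (A : 'M[C]_n) (l : 'rV[C]_n) :
  \tr (A *m diag_mx l) = \sum_i A i i * l 0 i.
Proof. by apply: eq_bigr => i _; rewrite mul_mx_diag mxE. Qed.

(* The unitary is the sign of [S - T], and [S + T >= |S - T|] on the diagonal
   in its eigenbasis. *)
Lemma powers_stormer n (S T : 'M[C]_n) : psd S -> psd T ->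
  exists2 V : 'M[C]_n, V *m V^t* = 1%:M &
    hsnorm2 (S - T) <= \tr (V *m (S *m S - T *m T)).
Proof.
move=> hS hT.
have Sa := psd_adj hS; have Ta := psd_adj hT.
have Dh : (S - T)^t* = S - T by rewrite adjmxB Sa Ta.
have [U [l [h1 h2 hl hD]]] := herm_spectral Dh.
pose sg : 'rV[C]_n := \row_i (if 0 <= l 0 i then 1 else -1).
have sgR i : sg 0 i \is Num.real by rewrite mxE; case: ifP; rewrite ?rpredN ?real1.
pose V := U^t* *m diag_mx sg *m U.
have Va : V^t* = V by apply: adj_conj_diag.
have VD : V *m (S - T) = U^t* *m diag_mx (\row_i `|l 0 i|) *m U.
  rewrite hD conj_diagM //; congr (_ *m diag_mx _ *m _); apply/rowP => i.
  rewrite !mxE; case: ifP => hli; first by rewrite mul1r ger0_norm.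
  by rewrite mulN1r ler0_norm // ltW // real_ltNge ?real0 // hli.
exists V.
  rewrite Va conj_diagM //.
  suff -> : diag_mx (\row_i (sg 0 i * sg 0 i)) = 1%:M by rewrite mulmx1.
  apply/matrixP => i j; rewrite !mxE; case: ifP => _; rewrite ?mulrNN mul1r //.
have DV : (S - T) *m V = V *m (S - T).
  rewrite -{1}Va -{1}Dh -adjmxM VD adj_conj_diag // => i.
  by rewrite mxE normr_real.
(* S^2 - T^2 is half of (S - T)(S + T) + (S + T)(S - T), and [V] commutes with [S - T]; the identity
   is checked after doubling. *)
have trE : \tr (V *m (S *m S - T *m T)) = \tr ((S + T) *m (V *m (S - T))).
  have two0 : (2%:R : C) != 0 by rewrite pnatr_eq0.
  apply: (mulIf two0); rewrite !mulr_natr !mulr2n.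
  have -> : \tr ((S + T) *m (V *m (S - T))) + \tr ((S + T) *m (V *m (S - T)))
     = \tr (V *m ((S - T) *m (S + T))) + \tr (V *m ((S + T) *m (S - T))).
    congr (_ + _); first by rewrite mxtrace_mulC !mulmxA.
    by rewrite -DV mxtrace_mulC -mulmxA mxtrace_mulC mulmxA.
  rewrite -!mxtraceD -!mulmxDr; congr (\tr (V *m _)).
  rewrite !(mulmxDl, mulmxDr, mulmxN, mulNmx).
  move: (S *m S) (S *m T) (T *m S) (T *m T) => a b c d.
  by apply/matrixP => i j; rewrite !mxE; ring.
rewrite trE VD.
have -> : hsnorm2 (S - T) = \sum_i `|l 0 i| * `|l 0 i|.
  rewrite hsnorm2_tr Dh hD conj_diagM // tr_conj_unitary // mxtrace_diag.
  by apply: eq_bigr => i _; rewrite !mxE -!expr2 real_normK.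
rewrite !mulmxA mxtrace_mulC !mulmxA tr_mul_diag.
apply: ler_sum => i _; rewrite [X in _ <= _ * X]mxE ler_wpM2r //.
have hST (X : 'M[C]_n) : psd X -> 0 <= (U *m X *m U^t*) i i.
  by move=> /(psd_congr (U^t*)) /(psd_diag_ge0 i); rewrite trmxCK.
have hli : l 0 i = (U *m (S - T) *m U^t*) i i.
  by rewrite (diag_conj_unitary h1 hD) mxE eqxx mulr1n.
rewrite real_ler_norml // hli mulmxDr mulmxBr mulmxDl mulmxBl.
have hD2 (A B : 'M[C]_n) : (A + B) i i = A i i + B i i by rewrite mxE.
have hB (A B : 'M[C]_n) : (A - B) i i = A i i - B i i by rewrite !mxE.
rewrite hD2 hB.
have := hST _ hS; have := hST _ hT.
move: ((U *m S *m U^t*) i i) ((U *m T *m U^t*) i i) => s t t0 s0.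
apply/andP; split; rewrite -subr_ge0.
  by rewrite (_ : _ - _ = s *+ 2) ?mulrn_wge0 //; ring.
by rewrite (_ : _ - _ = t *+ 2) ?mulrn_wge0 //; ring.
Qed.

(** Expanding (c r s v - y)^2 >= 0 gives the bound with r s in place of the mean of the squares,
    which is larger. The last hypothesis covers r s = 0, where the inverse is 0 and the second term
    gives nothing. *)
Lemma amgm_weighted (c v y r s : C) : 0 < c -> 0 <= v -> 0 <= y -> 0 <= r -> 0 <= s ->
  (r * s = 0 -> y = 0) ->
  v * y <= c / 2 * ((r ^+ 2 + s ^+ 2) / 2) * v ^+ 2 + (2 * c)^-1 * ((r * s)^-1 * y ^+ 2).
Proof.
move=> c0 v0 y0 r0 s0 hy.
have rs : r * s <= (r ^+ 2 + s ^+ 2) / 2.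
  rewrite ler_pdivlMr ?ltr0n // -subr_ge0.
  have -> : r ^+ 2 + s ^+ 2 - r * s * 2 = (r - s) ^+ 2 by ring.
  by rewrite -realEsqr realB ?ger0_real.
have [z|nz] := eqVneq (r * s) 0.
  rewrite (hy z) expr0n /= !mulr0 addr0.
  apply: mulr_ge0; last exact: exprn_ge0.
  apply: mulr_ge0; apply: divr_ge0; rewrite ?ler0n ?(ltW c0) //.
  by apply: addr_ge0; apply: exprn_ge0.
have p0 : 0 < r * s by rewrite lt_neqAle eq_sym nz mulr_ge0.
apply: (@le_trans _ _ (c / 2 * (r * s) * v ^+ 2 + (2 * c)^-1 * ((r * s)^-1 * y ^+ 2))).
  rewrite -subr_ge0.
  have -> : c / 2 * (r * s) * v ^+ 2 + (2 * c)^-1 * ((r * s)^-1 * y ^+ 2) - v * y =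
     (2 * c * (r * s))^-1 * (c * (r * s) * v - y) ^+ 2.
    have c1 := lt0r_neq0 c0; have p1 := lt0r_neq0 p0.
    move: p1; rewrite mulf_eq0 negb_or => /andP[r1 s1].
    by field; rewrite ?r1 ?s1 ?c1.
  have cp0 : 0 <= c * (r * s) by apply: mulr_ge0; apply: ltW.
  apply: mulr_ge0; first by rewrite invr_ge0 -mulrA mulr_ge0 ?ler0n.
  by rewrite -realEsqr realB ?ger0_real // mulr_ge0.
rewrite lerD2r ler_wpM2r ?exprn_ge0 // ler_wpM2l // divr_ge0 ?ler0n //.
exact: ltW.
Qed.

(** AM-GM on each product |V_ij| |Y_ji|. The weights r_k^2 and r_l^2 are summed separately, one
    against the rows and the other against the columns of [V], all of norm 1; each sum is q times
    the sum of the r_k^2, so the first term does not grow with [K]. *)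
Lemma weighted_trace_le K q (V Y : 'M[C]_(K * q)) (r : 'I_K -> C) (c : C) :
  0 < c -> V *m V^t* = 1%:M -> (forall k, 0 <= r k) -> \sum_k r k ^+ 2 = 1 ->
  (forall k a l b, r k * r l = 0 ->
     Y (mxtens_index (k, a)) (mxtens_index (l, b)) = 0) ->
  `|\tr (V *m Y)| <= c / 2 * q%:R + (2 * c)^-1 *
    \sum_k \sum_l (r k * r l)^-1 *
      \sum_a \sum_b `|Y (mxtens_index (k, a)) (mxtens_index (l, b))| ^+ 2.
Proof.
move=> c0 hV r0 r1 hY.
pose rr (i : 'I_(K * q)) := r (mxtens_unindex i).1.
have Vrow i : \sum_j `|V i j| ^+ 2 = 1.
  have /matrixP/(_ i i) := hV; rewrite !mxE eqxx mulr1n => <-.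
  by apply: eq_bigr => j _; rewrite adjmxE normCK.
have Vcol j : \sum_i `|V i j| ^+ 2 = 1.
  have /matrixP/(_ j j) := mulmx1C hV; rewrite !mxE eqxx mulr1n => <-.
  by apply: eq_bigr => i _; rewrite adjmxE normCKC.
have rrsum : \sum_i rr i ^+ 2 = q%:R.
  transitivity ((\sum_k r k ^+ 2) * q%:R); last by rewrite r1 mul1r.
  rewrite sum_mxtens_index mulr_suml; apply: eq_bigr => k _.
  under eq_bigr do rewrite /rr mxtens_indexK /=.
  by rewrite sumr_const card_ord mulr_natr.
apply: (@le_trans _ _ (\sum_i \sum_j `|V i j| * `|Y j i|)).
  apply: (le_trans (ler_norm_sum _ _ _)); apply: ler_sum => i _.
  rewrite mxE; apply: (le_trans (ler_norm_sum _ _ _)); apply: ler_sum => j _.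
  by rewrite normrM.
apply: (@le_trans _ _ (\sum_i \sum_j (c / 2 * ((rr i ^+ 2 + rr j ^+ 2) / 2) * `|V i j| ^+ 2
    + (2 * c)^-1 * ((rr i * rr j)^-1 * `|Y j i| ^+ 2)))).
  apply: ler_sum => i _; apply: ler_sum => j _.
  apply: amgm_weighted => //; rewrite /rr //.
  case: (mxtens_indexP i) => k a; case: (mxtens_indexP j) => l b.
  by rewrite !mxtens_indexK /= mulrC => /hY ->; rewrite normr0.
under eq_bigr do rewrite big_split /=.
rewrite big_split /=; apply: lerD.
  suff -> : \sum_i \sum_j c / 2 * ((rr i ^+ 2 + rr j ^+ 2) / 2) * `|V i j| ^+ 2 =
     c / 2 * q%:R by [].
  have e1 : \sum_i \sum_j rr i ^+ 2 * `|V i j| ^+ 2 = q%:R.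
    by rewrite -rrsum; apply: eq_bigr => i _; rewrite -mulr_sumr Vrow mulr1.
  have e2 : \sum_i \sum_j rr j ^+ 2 * `|V i j| ^+ 2 = q%:R.
    rewrite exchange_big -rrsum; apply: eq_bigr => i _.
    by rewrite -mulr_sumr Vcol mulr1.
  transitivity (c / 2 * ((\sum_i \sum_j rr i ^+ 2 * `|V i j| ^+ 2 +
     \sum_i \sum_j rr j ^+ 2 * `|V i j| ^+ 2) / 2)); last by rewrite e1 e2; field.
  rewrite -big_split /= mulr_suml mulr_sumr; apply: eq_bigr => i _.
  by rewrite -big_split /= mulr_suml mulr_sumr; apply: eq_bigr => j _; field.
have ex (g : 'I_(K * q) -> 'I_(K * q) -> C) :
  \sum_i \sum_j g i j = \sum_j \sum_i g i j by exact: exchange_big.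
rewrite le_eqVlt; apply/orP; left; apply/eqP; apply: etrans (ex _) _.
apply: etrans (sum2_mxtens_index _) _; rewrite mulr_sumr.
apply: eq_bigr => k _; rewrite mulr_sumr; apply: eq_bigr => l _.
rewrite !mulr_sumr; apply: eq_bigr => a _; rewrite !mulr_sumr; apply: eq_bigr => b _.
by rewrite /rr !mxtens_indexK /= [r l * _]mulrC.
Qed.

End PowersStormer.

(** * Decoding a nearly correctable code *)

Section Coding.
Variable C : numClosedFieldType.
Local Open Scope sesquilinear_scope.

(* Markov's inequality for the spectrum of [L]. *)
Lemma small_eigenspace n m (L : 'M[C]_n) (e : C) :
  psd L -> (m <= n)%N -> 0 <= e -> \tr L <= (n - m)%:R * e ->
  exists2 E : 'M[C]_(n, m), E^t* *m E = 1%:M &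
    forall x : 'cV[C]_m, (x^t* *m (E^t* *m L *m E) *m x) 0 0 <= e * hsnorm2 x.
Proof.
move=> hL hmn e0 htr; have [U [l [h1 h2 hl eL]]] := psd_spectral hL.
have lR i : l 0 i \is Num.real by apply: ger0_real.
have eR : e \is Num.real by apply: ger0_real.
pose good := [pred i | l 0 i <= e].
have hgood : (m <= #|good|)%N.
  rewrite leqNgt; apply/negP => hlt.
  have hbad : (n - m < #|predC good|)%N.
    have h : (#|good| + #|predC good|)%N = n by rewrite -[RHS]card_ord -(cardC good).
    by move: h hlt hmn; move: #|good| #|predC good| => a b; lia.
  have [i0 hi0] : exists i0, i0 \in predC good.
    by apply/card_gt0P; apply: leq_trans hbad.
  have : (\sum_(i in predC good) e : C) < \sum_(i in predC good) l 0 i.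
    apply: ltr_sum; first by apply/hasP; exists i0; rewrite ?mem_index_enum.
    by move=> i; rewrite !inE real_ltNge.
  rewrite sumr_const => hlt2.
  have : \sum_(i in predC good) l 0 i <= \tr L.
    rewrite eL tr_conj_unitary // mxtrace_diag [leRHS](bigID (mem (predC good))) /=.
    by rewrite lerDl sumr_ge0.
  move=> /(lt_le_trans hlt2) /lt_le_trans /(_ htr).
  by rewrite mulr_natl => /lt_geF; rewrite ler_wpMn2l // ltnW.
pose f (a : 'I_m) : 'I_n := enum_val (widen_ord hgood a).
have finj : injective f.
  by move=> a b /enum_val_inj /(congr1 val) /= h; apply: val_inj.
have fgood a : l 0 (f a) <= e by have := enum_valP (widen_ord hgood a).
pose F : 'M[C]_(n, m) := \matrix_(i, a) (i == f a)%:R.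
have FlF (s : 'rV[C]_n) : F^t* *m diag_mx s *m F = diag_mx (\row_a s 0 (f a)).
  apply/matrixP => a b; rewrite mul_mx_diag !mxE (bigD1 (f a)) //= big1 ?addr0.
    rewrite !mxE eqxx (inj_eq finj) rmorph1 mul1r.
    by case: eqVneq => _; rewrite ?mulr1 ?mulr0.
  by move=> i /negbTE ni; rewrite !mxE ni rmorph0 !mul0r.
exists (U^t* *m F).
  rewrite adjmxM trmxCK mulmxA -(mulmxA _ U) h1.
  have -> : (1%:M : 'M[C]_n) = diag_mx (\row_i 1).
    by apply/matrixP => i j; rewrite !mxE.
  rewrite FlF; apply/matrixP => i j; rewrite !mxE //.
move=> x; have -> : (U^t* *m F)^t* *m L *m (U^t* *m F) = diag_mx (\row_a l 0 (f a)).
  rewrite adjmxM trmxCK !mulmxA -FlF -(diag_conj_unitary h1 eL) !mulmxA //.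
rewrite quadE /hsnorm2 mulr_sumr; apply: ler_sum => a _.
rewrite (bigD1 a) //= big1 ?addr0.
  rewrite !mxE eqxx mulr1n big_ord1 mulrAC -normCKC mulrC.
  by apply: ler_wpM2r; [exact: exprn_ge0|exact: fgood].
by move=> b nb; rewrite !mxE eq_sym (negbTE nb) mulr0n mulr0 mul0r.
Qed.

(** This Gram matrix is the omega of the overview, the average of A_k^* A_l over the maximally mixed
    input. Its quadratic form at [v] is the squared norm of the combination of the A_l with
    coefficients v_l, over d. *)
Lemma tr_gram_psd K d (A : 'I_K -> 'M[C]_d) :
  psd (\matrix_(k, l) (\tr ((A k)^t* *m A l) / d%:R)).
Proof.
move=> v; rewrite quadE.
have -> : \sum_k \sum_l (v k 0)^* *
    (\matrix_(k, l) (\tr ((A k)^t* *m A l) / d%:R)) k l * v l 0 =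
    hsnorm2 (\sum_l v l 0 *: A l) / d%:R.
  rewrite hsnorm2_tr.
  have -> : (\sum_l v l 0 *: A l)^t* = \sum_k (v k 0)^* *: (A k)^t*.
    elim/big_rec2: _ => [|k X Y _ <-]; last by rewrite adjmxD adjmxZ.
    by apply/matrixP => i j; rewrite !mxE rmorph0.
  rewrite mulmx_suml raddf_sum mulr_suml; apply: eq_bigr => k _.
  rewrite mulmx_sumr raddf_sum mulr_suml; apply: eq_bigr => l _.
  by rewrite mxE -scalemxAl -scalemxAr /= !mxtraceZ; ring.
by rewrite divr_ge0 ?ler0n ?hsnorm2_ge0.
Qed.

Lemma kraus_isometry K d (A : 'I_K -> 'M[C]_d) q (X : 'M[C]_(d, q)) :
  \sum_k (A k)^t* *m A k = 1%:M -> \sum_k hsnorm2 (A k *m X) = hsnorm2 X.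
Proof.
move=> hA; rewrite [RHS]hsnorm2_tr -(mulmx1 (X^t*)) -hA mulmx_sumr mulmx_suml.
rewrite raddf_sum; apply: eq_bigr => k _.
by rewrite hsnorm2_tr adjmxM !mulmxA.
Qed.

(** If the Gram matrix were exactly omega (x) 1, its root would be [T], which leaves every code
    vector alone, and decoding would be perfect. The hypothesis, with [c] the free AM-GM parameter,
    bounds the total deviation of the root from [T] over the q dimensions of [W]; the m best
    dimensions each deviate by at most [e]. *)
Theorem code_of_isometry K d q m (A : 'I_K -> 'M[C]_d) (r : 'I_K -> C)
    (W : 'M[C]_(d, q)) (c e : C) :
  (0 < d)%N -> (m <= q)%N -> 0 < c -> 0 <= e ->
  \sum_k (A k)^t* *m A k = 1%:M ->
  (forall k, 0 <= r k) -> \sum_k r k ^+ 2 = 1 -> (forall k, r k = 0 -> A k = 0) ->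
  W^t* *m W = 1%:M ->
  c / 2 * q%:R + (2 * c)^-1 * \sum_k \sum_l (r k * r l)^-1 *
    hsnorm2 (W^t* *m ((A k)^t* *m A l - (\tr ((A k)^t* *m A l) / d%:R)%:M) *m W)
    <= (q - m)%:R * e ->
  exists W' : 'M[C]_(d, m), exists Rf : 'M[C]_(K * m, d),
  [/\ W'^t* *m W' = 1%:M, contraction Rf &
      forall x : 'cV[C]_m, hsnorm2 x = 1 ->
      1 - e <= \sum_k hsnorm2 (((1%:M : 'M[C]_K) *t x^t*) *m Rf *m (A k *m (W' *m x)))].
Proof.
move=> d0 hmq c0 e0 hA r0 r1 hr hW hc.
pose B := rowcat (fun k => A k *m W).
have [S [Rm [pS SS RB cR]]] := polar B.
have [tau [ptau tautau]] := psd_sqrt (tr_gram_psd A).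
have taua := psd_adj ptau; have Sa := psd_adj pS.
pose T := tau *t (1%:M : 'M[C]_q).
have p1 n : psd (1%:M : 'M[C]_n).
  by rewrite -[1%:M]mulmx1 -{1}adjmx1; apply: psd_gram.
have pT : psd T by apply: psd_tens.
(* For a unit vector [y] of the code, [1 - hsnorm2 t], where [t] collects the
   overlaps [y^* R_j A_k W y], is at most the quadratic form of [L] at [y]; the
   expurgation then keeps the small eigenvalues of [L]. *)
pose D := S - T; pose L := \sum_k (colblk D k)^t* *m colblk D k.
have hD : hsnorm2 D <= (q - m)%:R * e.
  have [V hV hPS] := powers_stormer pS pT.
  have x0 : 0 <= \tr (V *m (S *m S - T *m T)).
    by apply: le_trans hPS; apply: hsnorm2_ge0.
  apply: (le_trans hPS); rewrite -(ger0_norm x0); apply: le_trans hc.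
  have Yent k a l b : (S *m S - T *m T) (mxtens_index (k, a)) (mxtens_index (l, b)) =
    (W^t* *m ((A k)^t* *m A l - (\tr ((A k)^t* *m A l) / d%:R)%:M) *m W) a b.
    have entB (X Y : 'M[C]_(K * q)) i j : (X - Y) i j = X i j - Y i j by rewrite !mxE.
    have entB' (X Y : 'M[C]_q) i j : (X - Y) i j = X i j - Y i j by rewrite !mxE.
    have -> : (S *m S - T *m T) (mxtens_index (k, a)) (mxtens_index (l, b)) =
      ((colblk B k)^t* *m colblk B l) a b - (T *m T) (mxtens_index (k, a)) (mxtens_index (l, b)).
      by rewrite entB SS; congr (_ - _); rewrite !mxE; apply: eq_bigr => i _; rewrite !mxE.
    rewrite tensmx_mul mulmx1 tautau tensmxE !colblk_rowcat adjmxM.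
    rewrite mulmxBr mulmxBl entB' !mulmxA; congr (_ - _).
    rewrite mul_mx_scalar -scalemxAl hW !mxE.
    by case: eqVneq => _; rewrite ?mulr1 ?mulr0 ?mulr1n ?mulr0n.
  have := weighted_trace_le (Y := S *m S - T *m T) c0 hV r0 r1.
  have hY k a l b : r k * r l = 0 ->
      (S *m S - T *m T) (mxtens_index (k, a)) (mxtens_index (l, b)) = 0.
    move=> /eqP; rewrite mulf_eq0 Yent => /orP[] /eqP /hr ->.
      rewrite trmx0 map_mx0 mul0mx mxtrace0 mul0r.
      by rewrite (_ : 0%:M = 0) ?subrr ?mulmx0 ?mul0mx ?mxE //; apply/matrixP => i j; rewrite !mxE mul0rn.
    rewrite mulmx0 mxtrace0 mul0r.
    by rewrite (_ : 0%:M = 0) ?subrr ?mulmx0 ?mul0mx ?mxE //; apply/matrixP => i j; rewrite !mxE mul0rn.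
  move=> /(_ hY) /le_trans; apply; rewrite lerD2l le_eqVlt; apply/orP; left.
  apply/eqP; congr (_ * _); apply: eq_bigr => k _; apply: eq_bigr => l _.
  congr (_ * _); apply: eq_bigr => a _; apply: eq_bigr => b _.
  by rewrite Yent.
have pL : psd L by apply: psd_sum => k; apply: psd_gram.
have trL : \tr L = hsnorm2 D.
  by rewrite raddf_sum hsnorm2_colblk; apply: eq_bigr => k _; rewrite hsnorm2_tr.
rewrite -trL in hD.
have [E hE hsm] := small_eigenspace pL hmq e0 hD.
have e11 (x : 'cV[C]_m) : hsnorm2 x = 1 -> x^t* *m x = 1%:M.
  by rewrite -sqnormv => h; rewrite [LHS]mx11_scalar h.
exists (W *m E), (((1%:M : 'M[C]_K) *t E^t*) *m Rm); split.
- by rewrite adjmxM mulmxA -(mulmxA _ _ W) hW mulmx1.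
- apply: contractionM => //; apply: contraction_idem.
  rewrite adjmx_tens trmxCK adjmx1 !tensmx_mul !mulmx1 mulmxA -(mulmxA E) hE mulmx1 //.
move=> x hx; pose y := E *m x.
have hy : hsnorm2 y = 1 by rewrite hsnorm2_isometryl.
have yy : y^t* *m y = 1%:M by rewrite adjmxM mulmxA -(mulmxA _ _ E) hE mulmx1 e11.
pose Y := (1%:M : 'M[C]_K) *t y; pose t := Y^t* *m S *m Y.
pose tau1 := tau *t (1%:M : 'M[C]_1).
have YY : Y^t* *m Y = 1%:M by rewrite adjmx_tens adjmx1 tensmx_mul mulmx1 yy tens1mx1.
have TY : T *m Y = Y *m tau1 by rewrite !tensmx_mul !mul1mx !mulmx1.
(* The decoded amplitudes for the k-th Kraus operator form the k-th column of [t]. *)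
have -> : \sum_k hsnorm2 (((1%:M : 'M[C]_K) *t x^t*) *m ((1%:M : 'M[C]_K) *t E^t* *m Rm) *m
    (A k *m (W *m E *m x))) = hsnorm2 t.
  rewrite hsnorm2_colblk; apply: eq_bigr => k _; congr (hsnorm2 _).
  rewrite /t -RB mulmxA colblkMr !colblkMl colblk_rowcat /Y adjmx_tens adjmx1 /y.
  by rewrite adjmxM !mulmxA tensmx_mul mulmx1.
have St : t^t* = t by rewrite /t !adjmxM trmxCK Sa mulmxA.
have tau1a : tau1^t* = tau1 by rewrite /tau1 adjmx_tens adjmx1 taua.
(* [1 - hsnorm2 t] is the squared norm of the part of [S *m Y] outside the range of [Y]. As [T *m Y]
   lies in that range, this is also the outer part of [D *m Y]; the inner part is [t - tau1]. *)
have key : 1 - hsnorm2 t = hsnorm2 (D *m Y) - hsnorm2 (t - tau1).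
  have hBY : hsnorm2 (B *m Y) = 1.
    rewrite hsnorm2_colblk -hy -(hsnorm2_isometryl y hW) -(kraus_isometry _ hA).
    by apply: eq_bigr => k _; rewrite colblkMr colblk_rowcat mulmxA.
  have DY : D *m Y = S *m Y - Y *m tau1 by rewrite mulmxBl TY.
  have q1 : (S *m Y)^t* *m (S *m Y) = (B *m Y)^t* *m (B *m Y).
    by rewrite !adjmxM Sa -!mulmxA (mulmxA S S) SS !mulmxA.
  have q2 : (S *m Y)^t* *m (Y *m tau1) = t *m tau1 by rewrite adjmxM Sa !mulmxA.
  have q3 : (Y *m tau1)^t* *m (S *m Y) = tau1 *m t by rewrite adjmxM tau1a !mulmxA.
  have q4 : (Y *m tau1)^t* *m (Y *m tau1) = tau1 *m tau1.
    by rewrite adjmxM tau1a mulmxA -(mulmxA tau1) YY mulmx1.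
  rewrite -[in LHS]hBY !hsnorm2_tr DY !(adjmxB (S *m Y)) (adjmxB t) St tau1a.
  rewrite !mulmxBl !mulmxBr q1 q2 q3 q4 !raddfB /=; ring.
have hDY : hsnorm2 (D *m Y) <= e.
  have := hsm x; rewrite hx mulr1; apply: le_trans.
  rewrite le_eqVlt; apply/orP; left; apply/eqP.
  have -> : x^t* *m (E^t* *m L *m E) *m x = y^t* *m L *m y.
    by rewrite /y adjmxM !mulmxA.
  rewrite hsnorm2_colblk mulmx_sumr mulmx_suml summxE; apply: eq_bigr => k _.
  by rewrite quad_hsnorm2 colblkMr.
rewrite lerBlDr -lerBlDl key; apply: le_trans hDY.
by rewrite lerBlDr lerDl hsnorm2_ge0.
Qed.

End Coding.

(** * Random codes *)

Section RandomCode.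
Variable C : numClosedFieldType.
Local Open Scope sesquilinear_scope.

Lemma exists_le_average (T : finType) (f : T -> C) (a : C) : (0 < #|T|)%N ->
  (forall t, f t \is Num.real) -> a \is Num.real ->
  \sum_t f t <= #|T|%:R * a -> exists t, f t <= a.
Proof.
move=> T0 fR aR h; have [t ht|hn] := pickP (fun t => f t <= a); first by exists t.
have /card_gt0P[t0 _] := T0.
have : (\sum_(t : T) a : C) < \sum_t f t.
  apply: ltr_sum; first by apply/hasP; exists t0; rewrite ?mem_index_enum.
  by move=> t _; rewrite real_ltNge // hn.
by rewrite sumr_const -mulr_natl => /lt_le_trans /(_ h); rewrite ltxx.
Qed.

Lemma signr_negb (b : bool) : (-1) ^+ (~~ b) = - (-1) ^+ b :> C.
Proof. by case: b; rewrite ?opprK. Qed.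

(** * Random signs *)

Section Signs.
Variable d : nat.
Local Notation signs := {ffun 'I_d -> bool}.
Local Notation sg e i := ((-1) ^+ (e i : bool) : C).

Definition flip (x : 'I_d) (e : signs) : signs :=
  [ffun i => if i == x then ~~ e i else e i].

Lemma flipK x : involutive (flip x).
Proof. by move=> e; apply/ffunP => i; rewrite !ffunE; case: eqP; rewrite ?negbK. Qed.

Lemma sum_flip0 x (F : signs -> C) :
  (forall e, F (flip x e) = - F e) -> \sum_e F e = 0.
Proof.
move=> hF; have h : \sum_e F e = - \sum_e F e.
  rewrite {1}(reindex_inj (inv_inj (flipK x))) /= -sumrN.
  by apply: eq_bigr => e _.
by move/eqP: h; rewrite -subr_eq0 opprK -mulr2n mulrn_eq0 => /eqP.
Qed.

(** Flipping a sign that occurs an odd number of times negates the summand. As j <> k and l <> m,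
    only the two ways of pairing j, k with l, m survive. *)
Lemma sign_moment j k l m : j != k -> l != m ->
  \sum_(e : signs) sg e j * sg e k * (sg e l * sg e m) =
  #|{: signs}|%:R * (((j == l) && (k == m))%:R + ((j == m) && (k == l))%:R).
Proof.
move=> njk nlm.
have sq (e : signs) i : sg e i * sg e i = 1.
  by rewrite -expr2 sqrr_sign.
have sgf x (e : signs) i : sg (flip x e) i = if i == x then - sg e i else sg e i.
  by rewrite ffunE; case: eqP => // _; rewrite signr_negb.
have [ejl|njl] := eqVneq j l; last have [ejm|njm] := eqVneq j m.
- subst l; have [ekm|nkm] := eqVneq k m.
    subst m; rewrite (negbTE njk) /= addr0 mulr1 -sum1_card natr_sum.
    by apply: eq_bigr => e _; rewrite mulrACA !sq mulr1.
  rewrite (negbTE nlm) /= addr0 mulr0; apply: (sum_flip0 (x := k)) => e.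
  by rewrite !sgf eqxx (negbTE njk) (eq_sym m) (negbTE nkm); ring.
- subst m; have [ekl|nkl] := eqVneq k l.
    subst l; rewrite /= add0r mulr1 -sum1_card natr_sum.
    by apply: eq_bigr => e _; rewrite [sg e k * sg e j]mulrC mulrACA !sq mulr1.
  rewrite /= addr0 mulr0; apply: (sum_flip0 (x := k)) => e.
  by rewrite !sgf eqxx (negbTE njk) (eq_sym l) (negbTE nkl); ring.
rewrite /= addr0 mulr0; apply: (sum_flip0 (x := j)) => e.
rewrite !sgf eqxx (eq_sym k) (eq_sym l) (eq_sym m).
by rewrite (negbTE njk) (negbTE njl) (negbTE njm); ring.
Qed.

Lemma sum_delta (F : 'I_d -> 'I_d -> C) j k :
  \sum_l \sum_m F l m * ((j == l) && (k == m))%:R = F j k.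
Proof.
rewrite (bigD1 j) //= [X in _ + X]big1 ?addr0 => [|l nl].
  rewrite (bigD1 k) //= big1 ?addr0 => [|m nm]; first by rewrite !eqxx mulr1.
  by rewrite eqxx (eq_sym k) (negbTE nm) mulr0.
by rewrite big1 // => m _; rewrite (eq_sym j) (negbTE nl) mulr0.
Qed.

(** The terms j = k carry no sign and add up to the trace, which is 0. For the off-diagonal part
    [z], the two pairings of [sign_moment] give |z|^2 and the sum of z_jk times the conjugate of
    z_kj, itself at most |z|^2; hence the 2. *)
Lemma sign_average (y : 'M[C]_d) : \tr y = 0 ->
  \sum_(e : signs) `|\sum_j \sum_k sg e j * sg e k * y j k| ^+ 2
  <= #|{: signs}|%:R * (2 * hsnorm2 y).
Proof.
move=> try0; pose z j k := if j == k then 0 else y j k.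
have zsum (e : signs) : \sum_j \sum_k sg e j * sg e k * y j k =
    \sum_j \sum_k sg e j * sg e k * z j k.
  transitivity (\sum_j \sum_k sg e j * sg e k * z j k + \tr y); last by rewrite try0 addr0.
  rewrite /mxtrace -big_split /=; apply: eq_bigr => j _.
  rewrite (bigD1 j) //= [in RHS](bigD1 j) //= /z eqxx mulr0 add0r addrC.
  rewrite -expr2 sqrr_sign mul1r; congr (_ + _); apply: eq_bigr => k nk.
  by rewrite eq_sym (negbTE nk).
have zz : \sum_j \sum_k `|z j k| ^+ 2 <= hsnorm2 y.
  apply: ler_sum => j _; apply: ler_sum => k _; rewrite /z.
  by case: eqP => // _; rewrite normr0 expr0n exprn_ge0.
(* This is the nonnegativity of the sum of |z_jk - z_kj|^2. *)
have zswap : \sum_j \sum_k z j k * (z k j)^* <= \sum_j \sum_k `|z j k| ^+ 2.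
  have h0 : 0 <= \sum_j \sum_k `|z j k - z k j| ^+ 2.
    by apply: sumr_ge0 => j _; apply: sumr_ge0 => k _; rewrite exprn_ge0.
  have e1 : \sum_j \sum_k `|z j k - z k j| ^+ 2 =
     (\sum_j \sum_k `|z j k| ^+ 2 + \sum_j \sum_k `|z k j| ^+ 2) -
     (\sum_j \sum_k z j k * (z k j)^* + \sum_j \sum_k z k j * (z j k)^*).
    rewrite -!big_split /= -sumrB; apply: eq_bigr => j _.
    rewrite -!big_split /= -sumrB; apply: eq_bigr => k _.
    by rewrite !normCK rmorphB; ring.
  have sw (g : 'I_d -> 'I_d -> C) : \sum_j \sum_k g k j = \sum_j \sum_k g j k.
    exact: exchange_big.
  move: h0; rewrite e1 (sw (fun j k => `|z j k| ^+ 2)) (sw (fun j k => z j k * (z k j)^*)).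
  by rewrite -!mulr2n -mulrnBl pmulrn_lge0 // subr_ge0.
have -> : \sum_(e : signs) `|\sum_j \sum_k sg e j * sg e k * y j k| ^+ 2 =
   #|{: signs}|%:R * (\sum_j \sum_k `|z j k| ^+ 2 + \sum_j \sum_k z j k * (z k j)^*).
  transitivity (\sum_j \sum_k \sum_l \sum_m z j k * (z l m)^* *
     \sum_(e : signs) sg e j * sg e k * (sg e l * sg e m)).
    under eq_bigr => e _ do rewrite zsum.
    transitivity (\sum_(e : signs) \sum_j \sum_k \sum_l \sum_m
       z j k * (z l m)^* * (sg e j * sg e k * (sg e l * sg e m))).
      apply: eq_bigr => e _; rewrite normCK mulr_suml; apply: eq_bigr => j _.
      rewrite mulr_suml; apply: eq_bigr => k _.
      rewrite rmorph_sum mulr_sumr; apply: eq_bigr => l _.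
      rewrite rmorph_sum mulr_sumr; apply: eq_bigr => m _.
      by rewrite !rmorphM /= !rmorph_sign; ring.
    rewrite exchange_big; apply: eq_bigr => j _.
    rewrite exchange_big; apply: eq_bigr => k _.
    rewrite exchange_big; apply: eq_bigr => l _.
    rewrite exchange_big; apply: eq_bigr => m _.
    by rewrite mulr_sumr.
  rewrite -big_split mulr_sumr; apply: eq_bigr => j _.
  rewrite -big_split mulr_sumr; apply: eq_bigr => k _.
  transitivity (\sum_l \sum_m z j k * (z l m)^* * (#|{: signs}|%:R *
     (((j == l) && (k == m))%:R + ((j == m) && (k == l))%:R))).
    apply: eq_bigr => l _; apply: eq_bigr => m _; rewrite {1 3}/z.
    case: eqVneq => [|njk]; first by rewrite !mul0r.
    have [->|nlm] := eqVneq l m; first by rewrite /z eqxx rmorph0 mulr0 !mul0r.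
    by rewrite sign_moment.
  transitivity (\sum_l \sum_m (#|{: signs}|%:R * (z j k * (z l m)^*)) * ((j == l) && (k == m))%:R
    + \sum_m \sum_l (#|{: signs}|%:R * (z j k * (z l m)^*)) * ((j == m) && (k == l))%:R).
    rewrite [X in _ = _ + X]exchange_big -big_split; apply: eq_bigr => l _.
    by rewrite -big_split; apply: eq_bigr => m _ /=; ring.
  rewrite sum_delta (sum_delta (fun m l => #|{: signs}|%:R * (z j k * (z l m)^*))).
  by rewrite normCK /=; ring.
rewrite ler_wpM2l ?ler0n // mulr_natl mulr2n; apply: lerD => //.
exact: le_trans zz.
Qed.

End Signs.

(** The i-th diagonal entry in the signed basis is a sign form with coefficients conj(H_ji) X_jk
    H_ki. Flatness of [H] gives these coefficients trace tr X / d = 0 and squared norm |X|^2 / d^2;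
    summing 2 |X|^2 / d^2 over the d entries yields 2 / d. *)
Lemma flat_basis d (H : 'M[C]_d) (I : finType) (g : I -> C) (X : I -> 'M[C]_d) :
  (0 < d)%N ->
  H^t* *m H = 1%:M -> (forall i j, `|H i j| ^+ 2 = d%:R^-1) ->
  (forall q, 0 <= g q) -> (forall q, \tr (X q) = 0) ->
  exists2 B : 'M[C]_d, B^t* *m B = 1%:M &
    \sum_q g q * \sum_i `|(B^t* *m X q *m B) i i| ^+ 2
    <= 2 / d%:R * \sum_q g q * hsnorm2 (X q).
Proof.
move=> d0 hH hflat g0 trX.
pose Bs (e : {ffun 'I_d -> bool}) : 'M[C]_d := \matrix_(i, j) ((-1) ^+ (e i) * H i j).
have BsE e q i : (Bs e ^t* *m X q *m Bs e) i i =
   \sum_j \sum_k (-1) ^+ (e j) * (-1) ^+ (e k) * ((H j i)^* * X q j k * H k i).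
  rewrite mxE exchange_big; apply: eq_bigr => k _; rewrite mxE mulr_suml.
  by apply: eq_bigr => j _; rewrite !mxE rmorphM rmorph_sign /=; ring.
have dC : (d%:R : C) != 0 by rewrite pnatr_eq0 -lt0n.
have [||||e he] := exists_le_average
   (f := fun e => \sum_q g q * \sum_i `|(Bs e ^t* *m X q *m Bs e) i i| ^+ 2)
   (a := 2 / d%:R * \sum_q g q * hsnorm2 (X q)).
- by apply/card_gt0P; exists [ffun => true].
- move=> e; apply: ger0_real; apply: sumr_ge0 => q _; rewrite mulr_ge0 //.
  by apply: sumr_ge0 => i _; rewrite exprn_ge0.
- apply: ger0_real; rewrite mulr_ge0 ?divr_ge0 ?ler0n //.
  by apply: sumr_ge0 => q _; rewrite mulr_ge0 ?hsnorm2_ge0.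
- rewrite exchange_big !mulr_sumr; apply: ler_sum => q _.
  rewrite -mulr_sumr.
  have -> : #|{: {ffun 'I_d -> bool}}|%:R * (2 / d%:R * (g q * hsnorm2 (X q))) =
    g q * (#|{: {ffun 'I_d -> bool}}|%:R * (2 / d%:R * hsnorm2 (X q))) by ring.
  apply: ler_wpM2l => //; rewrite exchange_big /=.
  have -> : #|{: {ffun 'I_d -> bool}}|%:R * (2 / d%:R * hsnorm2 (X q)) =
    \sum_(i < d) #|{: {ffun 'I_d -> bool}}|%:R * (2 * ((d%:R^-1) ^+ 2 * hsnorm2 (X q))).
    by rewrite sumr_const card_ord -[RHS]mulr_natl; field.
  apply: ler_sum => i _.
  pose y : 'M[C]_d := \matrix_(j, k) ((H j i)^* * X q j k * H k i).
  have try0 : \tr y = 0.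
    transitivity (d%:R^-1 * \tr (X q)); last by rewrite trX mulr0.
    rewrite mulr_sumr; apply: eq_bigr => j _; rewrite mxE -(hflat j i) normCK; ring.
  have hy : hsnorm2 y = (d%:R^-1) ^+ 2 * hsnorm2 (X q).
    rewrite mulr_sumr; apply: eq_bigr => j _; rewrite mulr_sumr; apply: eq_bigr => k _.
    rewrite mxE !normrM !exprMn norm_conjC !hflat; ring.
  rewrite -hy; apply: le_trans (sign_average try0).
  rewrite le_eqVlt; apply/orP; left; apply/eqP; apply: eq_bigr => e _.
  congr (`|_| ^+ 2); rewrite BsE; apply: eq_bigr => j _; apply: eq_bigr => k _.
  by rewrite mxE.
exists (Bs e) => //; rewrite -hH; apply/matrixP => i j; rewrite !mxE.
apply: eq_bigr => k _; rewrite !mxE rmorphM rmorph_sign /= mulrACA -expr2 sqrr_sign.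
by rewrite mul1r.
Qed.

(** * Random subsets of a basis *)

Section Subset.
Variables (d : nat) (a : 'I_d -> 'I_d -> C).
Hypothesis a0 : forall i j, 0 <= a i j.

Let P i j := \sum_(s : {perm 'I_d}) a (s i) (s j).

(** The symmetric group acts transitively on the diagonal pairs and on the off-diagonal pairs. *)
Lemma perm_sum_shift i j i' j' : (i == j) = (i' == j') -> P i j = P i' j'.
Proof.
move=> h; suff [t [ti tj]] : exists t : {perm 'I_d}, t i = i' /\ t j = j'.
  rewrite /P [RHS](reindex_inj (mulgI t^-1%g)) /=; apply: eq_bigr => s _.
  by rewrite !permM -ti -tj !permK.
(* The first transposition sends i to i'; the second sends the image of j to j' and, off the
   diagonal, fixes i'. *)
exists (tperm i i' * tperm (tperm i i' j) j')%g; rewrite !permM tpermL.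
case: (eqVneq i j) h => [<- /esym/eqP <-|nij /esym/negbT nij'].
  by rewrite tpermL tpermL.
rewrite tpermL; split => //; rewrite tpermD // 1?eq_sym //.
by rewrite -{1}(tpermL i i') (inj_eq perm_inj).
Qed.

(** Double counting: [P] is constant on the diagonal, and a permutation does not change the full
    diagonal sum. The off-diagonal case below is the same with d (d - 1) positions. *)
Lemma sum_perm_diag i : P i i * d%:R = #|{: {perm 'I_d}}|%:R * \sum_j a j j.
Proof.
transitivity (\sum_j P j j).
  rewrite mulr_natr (eq_bigr (fun=> P i i)) => [|j _].
    by rewrite sumr_const card_ord.
  by apply: perm_sum_shift; rewrite !eqxx.
rewrite exchange_big mulr_natl -sumr_const; apply: eq_bigr => s _.
by rewrite [RHS](reindex_inj (@perm_inj _ s)).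
Qed.

Lemma sum_perm_offdiag i j : i != j ->
  P i j * (d%:R * (d.-1)%:R) =
  #|{: {perm 'I_d}}|%:R * \sum_k \sum_(l | l != k) a k l.
Proof.
move=> nij; transitivity (\sum_k \sum_(l | l != k) P k l).
  transitivity (\sum_(k < d) P i j * (d.-1)%:R).
    by rewrite sumr_const card_ord -mulr_natr; ring.
  apply: eq_bigr => k _; rewrite mulr_natr.
  rewrite (eq_bigr (fun=> P i j)) => [|l nl].
    by rewrite sumr_const (eq_card (_ : _ =i predC1 k)) ?cardC1 ?card_ord.
  by apply: perm_sum_shift; rewrite (negbTE nij) eq_sym (negbTE nl).
transitivity (\sum_(s : {perm 'I_d}) \sum_k \sum_(l | l != k) a (s k) (s l)).
  rewrite [RHS]exchange_big; apply: eq_bigr => k _.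
  by rewrite [RHS]exchange_big.
rewrite mulr_natl -sumr_const; apply: eq_bigr => s _.
rewrite [RHS](reindex_inj (@perm_inj _ s)); apply: eq_bigr => k _.
rewrite [RHS](reindex_inj (@perm_inj _ s)); apply: eq_bigl => l.
by rewrite (inj_eq perm_inj).
Qed.

(** Average over the images of the first m indices under all permutations. A diagonal entry is kept
    with probability m/d, an off-diagonal one with probability m (m - 1) / (d (d - 1)), which is at
    most (m/d)^2 because m <= d. *)
Lemma good_subset m : (m <= d)%N -> exists2 f : 'I_m -> 'I_d, injective f &
  \sum_i \sum_j a (f i) (f j) <=
  m%:R / d%:R * \sum_i a i i + (m%:R / d%:R) ^+ 2 * \sum_i \sum_j a i j.
Proof.
move=> hmd; pose w := widen_ord hmd.
have wi : injective w by move=> x y /(congr1 val) /= h; apply: val_inj.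
(* For m = 0 the ambient dimension may be 0 too, and the averages below divide by it. *)
have [m0|mpos] := posnP m.
  exists w => //; have -> : \sum_i \sum_j a (w i) (w j) = 0.
    by apply: big1 => -[i hi]; exfalso; rewrite m0 in hi.
  by rewrite m0 !mul0r expr0n /= mul0r addr0.
have d0 : (0 < d)%N by exact: (leq_trans mpos hmd).

have dC : (d%:R : C) != 0 by rewrite pnatr_eq0 -lt0n.
have sum0 : 0 <= \sum_k \sum_(l | l != k) a k l.
  by apply: sumr_ge0 => k _; apply: sumr_ge0.
have [||||s hs] := exists_le_average
   (f := fun s : {perm 'I_d} => \sum_i \sum_j a (s (w i)) (s (w j)))
   (a := m%:R / d%:R * \sum_i a i i + (m%:R / d%:R) ^+ 2 * \sum_i \sum_j a i j).
- by apply/card_gt0P; exists 1%g.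
- by move=> s; apply: ger0_real; apply: sumr_ge0 => i _; apply: sumr_ge0.
- apply: ger0_real; apply: addr_ge0; apply: mulr_ge0; rewrite ?exprn_ge0 ?divr_ge0 ?ler0n //.
    exact: sumr_ge0.
  by apply: sumr_ge0 => i _; apply: sumr_ge0.
- have -> : \sum_(s : {perm 'I_d}) \sum_i \sum_j a (s (w i)) (s (w j)) =
     \sum_i P (w i) (w i) + \sum_i \sum_(j | j != i) P (w i) (w j).
    rewrite exchange_big -big_split; apply: eq_bigr => i _ /=.
    by rewrite exchange_big (bigD1 i) //=.
  rewrite mulrDr; apply: lerD.
    apply: (@le_trans _ _ (\sum_(i < m) #|{: {perm 'I_d}}|%:R / d%:R * \sum_j a j j)).
      rewrite le_eqVlt; apply/orP; left; apply/eqP; apply: eq_bigr => i _.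
      by apply: (mulIf dC); rewrite sum_perm_diag; field.
    rewrite sumr_const card_ord le_eqVlt; apply/orP; left; apply/eqP.
    by rewrite -[LHS]mulr_natl; field.
  (* With at most one index there is no off-diagonal pair; d - 1, which might vanish then, becomes a
     denominator in the other case. *)
  have [m1|mgt1] := leqP m 1.
    rewrite big1 => [|i _]; last first.
      apply: big1 => j nji; case/negP: nji; apply/eqP; apply: val_inj.
      by move: (ltn_ord i) (ltn_ord j) m1 => /=; lia.
    rewrite mulr_ge0 ?ler0n // mulr_ge0 // ?exprn_ge0 ?divr_ge0 ?ler0n //.
    by apply: sumr_ge0 => i _; apply: sumr_ge0.
  have dd : ((d.-1)%:R : C) != 0 by rewrite pnatr_eq0; lia.
  apply: (@le_trans _ _ (\sum_(i < m) \sum_(j < m | j != i) #|{: {perm 'I_d}}|%:R / (d%:R * (d.-1)%:R) *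
     \sum_k \sum_(l | l != k) a k l)).
    rewrite le_eqVlt; apply/orP; left; apply/eqP; apply: eq_bigr => i _.
    apply: eq_bigr => j nji; have dd' : (d%:R * (d.-1)%:R : C) != 0 by rewrite mulf_neq0.
    apply: (mulIf dd'); rewrite sum_perm_offdiag ?(inj_eq wi) 1?eq_sym //.
    by field; rewrite dC dd.
  under eq_bigr => i _ do rewrite sumr_const (eq_card (_ : _ =i predC1 i)) // cardC1 card_ord.
  rewrite sumr_const card_ord; set O := \sum_k \sum_(l | l != k) a k l.
  have -> : (#|{: {perm 'I_d}}|%:R / (d%:R * (d.-1)%:R) * O) *+ m.-1 *+ m =
     #|{: {perm 'I_d}}|%:R * ((m%:R * (m.-1)%:R / (d%:R * (d.-1)%:R)) * O).
    by rewrite -[LHS]mulr_natr -[X in X * _]mulr_natr; field; rewrite dC dd.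
  apply: ler_wpM2l; first exact: ler0n.
  apply: ler_pM; [by rewrite divr_ge0 ?mulr_ge0 ?ler0n|exact: sum0| |].
  + have -> : (m%:R / d%:R) ^+ 2 = m%:R * m%:R / (d%:R * d%:R) :> C by field.
    have dp : 0 < d%:R :> C by rewrite ltr0n.
    have dp1 : 0 < (d.-1)%:R :> C by rewrite ltr0n; lia.
    rewrite ler_pdivrMr ?(mulr_gt0 dp dp1) // mulrAC ler_pdivlMr ?(mulr_gt0 dp dp) //.
    have hmd' : (m.-1 * d <= m * d.-1)%N by nia.
    rewrite -!natrM ler_nat (_ : m * m.-1 * _ = m * d * (m.-1 * d))%N; last by ring.
    by rewrite (_ : m * m * _ = m * d * (m * d.-1))%N ?leq_mul2l ?hmd' ?orbT //; ring.
  + apply: ler_sum => k _; rewrite [leRHS](bigD1 k) //= lerDr //.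
exists (fun i => s (w i)) => //; apply: inj_comp wi; exact: perm_inj.
Qed.

End Subset.

(** The diagonal contributes (m/d) (2/d), at most 2 (m/d)^2 since m <= m^2, and the rest at most
    (m/d)^2: this is the constant 3. *)
Theorem random_code d m (H : 'M[C]_d) (I : finType) (g : I -> C) (X : I -> 'M[C]_d) :
  (0 < d)%N -> (m <= d)%N ->
  H^t* *m H = 1%:M -> (forall i j, `|H i j| ^+ 2 = d%:R^-1) ->
  (forall q, 0 <= g q) -> (forall q, \tr (X q) = 0) ->
  exists2 W : 'M[C]_(d, m), W^t* *m W = 1%:M &
    \sum_q g q * hsnorm2 (W^t* *m X q *m W)
    <= 3 * (m%:R / d%:R) ^+ 2 * \sum_q g q * hsnorm2 (X q).
Proof.
move=> d0 hmd hH hflat g0 trX.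
have [B hB hdiag] := flat_basis d0 hH hflat g0 trX.
pose a i j := \sum_q g q * `|(B^t* *m X q *m B) i j| ^+ 2.
have a0 i j : 0 <= a i j by apply: sumr_ge0 => q _; rewrite mulr_ge0 ?exprn_ge0.
have [f finj hf] := good_subset a0 hmd.
exists (\matrix_(i, b) B i (f b)).
  apply/matrixP => i j; have /matrixP/(_ (f i) (f j)) := hB.
  rewrite !mxE (inj_eq finj) => <-; apply: eq_bigr => k _; by rewrite !mxE.
have -> : \sum_q g q * hsnorm2 ((\matrix_(i, b) B i (f b))^t* *m X q *m (\matrix_(i, b) B i (f b)))
   = \sum_i \sum_j a (f i) (f j).
  rewrite /a; under [RHS]eq_bigr => i _ do rewrite exchange_big /=.
  rewrite [RHS]exchange_big /=; apply: eq_bigr => q _.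
  rewrite mulr_sumr; apply: eq_bigr => i _; rewrite mulr_sumr; apply: eq_bigr => j _.
  congr (_ * `|_| ^+ 2); rewrite !mxE; apply: eq_bigr => k _; rewrite !mxE; congr (_ * _).
  by apply: eq_bigr => l _; rewrite !mxE.
apply: (le_trans hf); set A := \sum_q g q * hsnorm2 (X q).
have A0 : 0 <= A by apply: sumr_ge0 => q _; rewrite mulr_ge0 ?hsnorm2_ge0.
have -> : \sum_i \sum_j a i j = A.
  rewrite /a; under eq_bigr => i _ do rewrite exchange_big /=.
  rewrite exchange_big /=; apply: eq_bigr => q _.
  under eq_bigr => i _ do rewrite -mulr_sumr.
  rewrite -mulr_sumr -/(hsnorm2 _) -mulmxA hsnorm2_isometryl ?hsnorm2_coisometryr //.
    exact: mulmx1C.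
  by rewrite trmxCK; apply: mulmx1C.
have hdg : \sum_i a i i <= 2 / d%:R * A.
  apply: le_trans hdiag; rewrite /a exchange_big le_eqVlt; apply/orP; left.
  by apply/eqP; apply: eq_bigr => q _; rewrite mulr_sumr.
apply: (@le_trans _ _ (m%:R / d%:R * (2 / d%:R * A) + (m%:R / d%:R) ^+ 2 * A)).
  by rewrite lerD2r ler_wpM2l ?divr_ge0 ?ler0n.
have dC : (d%:R : C) != 0 by rewrite pnatr_eq0 -lt0n.
have -> : m%:R / d%:R * (2 / d%:R * A) = 2 * (m%:R / d%:R ^+ 2) * A by field.
rewrite -mulrDl ler_wpM2r //.
have -> : 3 * (m%:R / d%:R) ^+ 2 = 2 * (m%:R / d%:R) ^+ 2 + (m%:R / d%:R) ^+ 2 :> C by ring.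
rewrite lerD2r ler_wpM2l ?ler0n // expr_div_n ler_wpM2r ?invr_ge0 ?exprn_ge0 ?ler0n //.
by rewrite -natrX ler_nat; nia.
Qed.

End RandomCode.

(** * Codes for Kraus operators: choice of the parameters *)

Section KrausCode.
Variable C : numClosedFieldType.
Local Open Scope sesquilinear_scope.

(** Pythagoras: the subtracted scalar is the Hilbert-Schmidt projection of [X] on the scalar
    matrices. *)
Lemma hsnorm2_traceless d (X : 'M[C]_d) : (0 < d)%N ->
  hsnorm2 (X - (\tr X / d%:R)%:M) = hsnorm2 X - `|\tr X| ^+ 2 / d%:R.
Proof.
move=> d0; have dC : (d%:R : C) != 0 by rewrite pnatr_eq0 -lt0n.
rewrite !hsnorm2_tr adjmxB adjmx_scalar mulmxBl !mulmxBr mul_mx_scalar mul_scalar_mx.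
rewrite -scalar_mxM !raddfB /= !mxtraceZ mxtrace_scalar.
have -> : \tr (X^t*) = (\tr X)^*.
  by rewrite /mxtrace rmorph_sum; apply: eq_bigr => i _; rewrite !mxE.
by rewrite rmorphM fmorphV rmorph_nat normCK -mulr_natr; field.
Qed.

(** In terms of entropy this is D_2 >= - log d; it ensures that the code dimensions asked for fit in
    the space. The terms k = l suffice, each bounded by t_k^2 / (d r_k^2) through the previous
    lemma. *)
Lemma overlap_sum_ge K d (A : 'I_K -> 'M[C]_d) (r : 'I_K -> C) :
  (0 < d)%N -> \sum_k (A k)^t* *m A k = 1%:M -> (forall k, 0 <= r k) ->
  \sum_k r k ^+ 2 = 1 -> (forall k, r k = 0 -> A k = 0) ->
  d%:R <= \sum_k \sum_l (r k * r l)^-1 * hsnorm2 ((A k)^t* *m A l).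
Proof.
move=> d0 hA r0 r1 hr; have dC : (d%:R : C) != 0 by rewrite pnatr_eq0 -lt0n.
pose t k := \tr ((A k)^t* *m A k).
have t0 k : 0 <= t k by rewrite /t -hsnorm2_tr hsnorm2_ge0.
have tsum : \sum_k t k = d%:R by rewrite -[RHS]mxtrace1 -hA raddf_sum.
apply: (@le_trans _ _ (\sum_k (r k * r k)^-1 * hsnorm2 ((A k)^t* *m A k))); last first.
  apply: ler_sum => k _; rewrite [leRHS](bigD1 k) //= lerDl sumr_ge0 // => l _.
  by rewrite mulr_ge0 ?invr_ge0 ?mulr_ge0 ?hsnorm2_ge0.
(* The tangent bound t^2 / (d r^2) >= 2 t - d r^2 replaces Cauchy-Schwarz by a termwise inequality,
   which also makes sense at r = 0. *)
have -> : d%:R = \sum_k (2 * t k - d%:R * r k ^+ 2).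
  by rewrite sumrB -!mulr_sumr r1 tsum; ring.
apply: ler_sum => k _; have [rk|rk] := eqVneq (r k) 0.
  rewrite /t (hr k rk) rk expr0n /= !mulr0 subr0 mulmx0 mxtrace0 mulr0.
  by rewrite invr0 mul0r.
have rp : 0 < r k by rewrite lt_neqAle eq_sym rk r0.
have h1 : t k ^+ 2 / d%:R <= hsnorm2 ((A k)^t* *m A k).
  rewrite -subr_ge0 -(ger0_norm (t0 k)) -hsnorm2_traceless //.
  exact: hsnorm2_ge0.
apply: (@le_trans _ _ ((r k * r k)^-1 * (t k ^+ 2 / d%:R))); last first.
  by rewrite ler_wpM2l ?invr_ge0 ?mulr_ge0.
rewrite -subr_ge0.
have -> : (r k * r k)^-1 * (t k ^+ 2 / d%:R) - (2 * t k - d%:R * r k ^+ 2) =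
   d%:R^-1 * (t k / r k - d%:R * r k) ^+ 2 by field; rewrite rk dC.
rewrite mulr_ge0 ?invr_ge0 ?ler0n //.
by rewrite -realEsqr realB ?ger0_real ?divr_ge0 ?(mulr_ge0 (ler0n _ _)) .
Qed.

Theorem kraus_code K d m (A : 'I_K -> 'M[C]_d) (r : 'I_K -> C) (H : 'M[C]_d) (e : C) :
  (0 < d)%N -> (0 < m)%N -> 0 < e -> e <= 2 ->
  \sum_k (A k)^t* *m A k = 1%:M ->
  (forall k, 0 <= r k) -> \sum_k r k ^+ 2 = 1 -> (forall k, r k = 0 -> A k = 0) ->
  H^t* *m H = 1%:M -> (forall i j, `|H i j| ^+ 2 = d%:R^-1) ->
  128 * m%:R * \sum_k \sum_l (r k * r l)^-1 * hsnorm2 ((A k)^t* *m A l)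
    <= e ^+ 2 * d%:R ^+ 2 ->
  exists W' : 'M[C]_(d, m), exists Rf : 'M[C]_(K * m, d),
  [/\ W'^t* *m W' = 1%:M, contraction Rf &
      forall x : 'cV[C]_m, hsnorm2 x = 1 ->
      1 - e <= \sum_k hsnorm2 (((1%:M : 'M[C]_K) *t x^t*) *m Rf *m (A k *m (W' *m x)))].
Proof.
move=> d0 m0 e0 e2 hA r0 r1 hr hH hflat.
set S := \sum_k _ => hS.
have dC : (d%:R : C) != 0 by rewrite pnatr_eq0 -lt0n.
have dp : 0 < d%:R :> C by rewrite ltr0n.
have ene : e != 0 by rewrite gt_eqF.
(* [d <= S] and [e <= 2] turn the hypothesis into 128 m d <= 4 d^2. *)
have h2m : (2 * m <= d)%N.
  have hSd : d%:R <= S by apply: overlap_sum_ge.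
  have : 128 * m%:R * d%:R <= 4 * d%:R ^+ 2 :> C.
    apply: (@le_trans _ _ (128 * m%:R * S)).
      by rewrite ler_wpM2l // mulr_ge0 ?ler0n.
    apply: (le_trans hS); rewrite ler_wpM2r ?exprn_ge0 ?ler0n //.
    rewrite (_ : 4 = 2 ^+ 2); last by ring.
    by rewrite lerXn2r // nnegrE ?ler0n // ltW.
  by rewrite -natrX -!natrM ler_nat; nia.
pose g (q : 'I_K * 'I_K) : C := (r q.1 * r q.2)^-1.
pose X (q : 'I_K * 'I_K) := (A q.1)^t* *m A q.2.
pose X0 q := X q - (\tr (X q) / d%:R)%:M.
have g0 q : 0 <= g q by rewrite invr_ge0 mulr_ge0.
have trX0 q : \tr (X0 q) = 0.
  by rewrite raddfB /= mxtrace_scalar -[X in _ - X]mulr_natr mulfVK // subrr.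
have [W hW hWs] := random_code d0 h2m hH hflat g0 trX0.
have hs : \sum_k \sum_l (r k * r l)^-1 *
    hsnorm2 (W^t* *m ((A k)^t* *m A l - (\tr ((A k)^t* *m A l) / d%:R)%:M) *m W)
    <= 3 * ((2 * m)%:R / d%:R) ^+ 2 * S.
  rewrite pair_bigA /=; apply: le_trans hWs _.
  rewrite ler_wpM2l ?mulr_ge0 ?exprn_ge0 ?divr_ge0 ?invr_ge0 ?ler0n //.
  rewrite /S pair_bigA /=; apply: ler_sum => q _; rewrite ler_wpM2l //.
  rewrite hsnorm2_traceless // lerBlDr lerDl divr_ge0 ?exprn_ge0 ?ler0n //.
(* With q = 2 m and c = e / 4 the two terms are at most e m / 4 and 3 e m / 16, within the budget (q
   - m) e = e m. *)
apply: (code_of_isometry (q := (2 * m)%N) (W := W) (c := e / 4) (r := r)) => //.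
- by rewrite mul2n -addnn leq_addr.
- by rewrite divr_gt0 ?ltr0n.
- exact: ltW.
have ip : 0 <= (2 * (e / 4))^-1 by rewrite invr_ge0 mulr_ge0 ?divr_ge0 ?ler0n // ltW.
apply: (@le_trans _ _ (e / 4 / 2 * (2 * m)%:R +
    (2 * (e / 4))^-1 * (3 * ((2 * m)%:R / d%:R) ^+ 2 * S))).
  by rewrite lerD2l ler_wpM2l.
have -> : e / 4 / 2 * (2 * m)%:R + (2 * (e / 4))^-1 * (3 * ((2 * m)%:R / d%:R) ^+ 2 * S) =
   e * m%:R / 4 + (3 * m%:R / (16 * e * d%:R ^+ 2)) * (128 * m%:R * S).
  by rewrite natrM; field; rewrite ene dC.
apply: (@le_trans _ _ (e * m%:R / 4 + (3 * m%:R / (16 * e * d%:R ^+ 2)) * (e ^+ 2 * d%:R ^+ 2))).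
  rewrite lerD2l ler_wpM2l //.
  by rewrite divr_ge0 ?mulr_ge0 ?exprn_ge0 ?ler0n // ltW.
have -> : e * m%:R / 4 + (3 * m%:R / (16 * e * d%:R ^+ 2)) * (e ^+ 2 * d%:R ^+ 2) =
   (7 / 16) * (m%:R * e) by field; rewrite ene dC.
rewrite (_ : (2 * m - m)%N = m); last by rewrite mul2n -addnn addnK.
have me0 : 0 <= m%:R * e by rewrite mulr_ge0 ?ler0n // ltW.
rewrite -[leRHS]mul1r ler_wpM2r // ler_pdivrMr ?ltr0n // mul1r ler_nat //.
Qed.

End KrausCode.

(** * Kraus channels and fidelity *)

Section Kraus.
Variable R : realType.
Local Notation C := R[i].
Local Open Scope sesquilinear_scope.

Definition kraus (I : finType) p q (A : I -> 'M[C]_(q, p)) (X : 'M[C]_p) : 'M[C]_q :=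
  \sum_k A k *m X *m (A k)^t*.

Lemma tens_suml (I : finType) m n p q (F : I -> 'M[C]_(m, n)) (B : 'M[C]_(p, q)) :
  (\sum_i F i) *t B = \sum_i (F i *t B).
Proof.
apply/matrixP => i j; rewrite !mxE !summxE mulr_suml.
by apply: eq_bigr => k _; rewrite !mxE.
Qed.

Lemma tens_sumr (I : finType) m n p q (A : 'M[C]_(m, n)) (F : I -> 'M[C]_(p, q)) :
  A *t (\sum_i F i) = \sum_i (A *t F i).
Proof.
apply/matrixP => i j; rewrite !mxE !summxE mulr_sumr.
by apply: eq_bigr => k _; rewrite !mxE.
Qed.

Lemma tensmxZl m n p q (a : C) (A : 'M[C]_(m, n)) (B : 'M[C]_(p, q)) :
  (a *: A) *t B = a *: (A *t B).
Proof. by apply/matrixP => i j; rewrite !mxE mulrA. Qed.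

Lemma tensmxZr m n p q (a : C) (A : 'M[C]_(m, n)) (B : 'M[C]_(p, q)) :
  A *t (a *: B) = a *: (A *t B).
Proof. by apply/matrixP => i j; rewrite !mxE mulrCA. Qed.

Lemma mx_sum_tens_delta p q (X : 'M[C]_(p * q)) :
  X = \sum_(i < p) \sum_(j < p) \sum_(k < q) \sum_(l < q)
    X (mxtens_index (i, k)) (mxtens_index (j, l)) *: (delta_mx i j *t delta_mx k l).
Proof.
apply/matrixP => a b; case: (mxtens_indexP a) => i k; case: (mxtens_indexP b) => j l.
rewrite summxE (bigD1 i) //= [X in _ + X]big1 ?addr0 => [|i' ni]; last first.
  rewrite !summxE big1 // => j' _; rewrite !summxE big1 // => k' _.
  rewrite !summxE big1 // => l' _; rewrite mxE tensmxE mxE.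
  by rewrite (eq_sym i) (negbTE ni) mul0r mulr0.
rewrite summxE (bigD1 j) //= [X in _ + X]big1 ?addr0 => [|j' nj]; last first.
  rewrite !summxE big1 // => k' _.
  rewrite !summxE big1 // => l' _; rewrite mxE tensmxE mxE.
  by rewrite (eq_sym j) (negbTE nj) andbF mul0r mulr0.
rewrite summxE (bigD1 k) //= [X in _ + X]big1 ?addr0 => [|k' nk]; last first.
  rewrite !summxE big1 // => l' _; rewrite mxE tensmxE !mxE.
  by rewrite (eq_sym k) (negbTE nk) !mulr0.
rewrite summxE (bigD1 l) //= [X in _ + X]big1 ?addr0 => [|l' nl]; last first.
  by rewrite mxE tensmxE !mxE (eq_sym l) (negbTE nl) andbF !mulr0.
by rewrite mxE tensmxE !mxE !eqxx !mulr1.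
Qed.

Lemma tens_map_kraus (I J : finType) p p' q q' (A : I -> 'M[C]_(p', p))
    (B : J -> 'M[C]_(q', q)) (X : 'M[C]_(p * q)) :
  tens_map (kraus A) (kraus B) X =
  kraus (fun ij : I * J => A ij.1 *t B ij.2) X.
Proof.
rewrite {2}[X]mx_sum_tens_delta /kraus /tens_map.
rewrite -[RHS]/(\sum_k (fun ij : I * J => (A ij.1 *t B ij.2) *m _ *m (A ij.1 *t B ij.2)^t*) k).
rewrite (eq_bigr (fun k : I * J => \sum_(i < p) \sum_(j < p) \sum_(k' < q) \sum_(l < q)
    X (mxtens_index (i, k')) (mxtens_index (j, l)) *:
    ((A k.1 *m delta_mx i j *m (A k.1)^t*) *t (B k.2 *m delta_mx k' l *m (B k.2)^t*)))); last first.
  move=> k _; rewrite mulmx_sumr mulmx_suml; apply: eq_bigr => i _.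
  rewrite mulmx_sumr mulmx_suml; apply: eq_bigr => j _.
  rewrite mulmx_sumr mulmx_suml; apply: eq_bigr => k' _.
  rewrite mulmx_sumr mulmx_suml; apply: eq_bigr => l _.
  by rewrite -scalemxAr -scalemxAl adjmx_tens !tensmx_mul.
rewrite [RHS]exchange_big; apply: eq_bigr => i _ /=.
rewrite [RHS]exchange_big; apply: eq_bigr => j _ /=.
rewrite [RHS]exchange_big; apply: eq_bigr => k' _ /=.
rewrite [RHS]exchange_big; apply: eq_bigr => l _ /=.
rewrite -scaler_sumr; congr (_ *: _).
rewrite tens_suml; transitivity (\sum_a \sum_b
  (A a *m delta_mx i j *m (A a)^t*) *t (B b *m delta_mx k' l *m (B b)^t*)).
  by apply: eq_bigr => a _; rewrite tens_sumr.
by rewrite pair_bigA.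
Qed.

Lemma kraus_id p (X : 'M[C]_p) : kraus (fun _ : unit => 1%:M) X = X.
Proof.
rewrite /kraus (bigD1 tt) //= big1 => [|[] //].
by rewrite adjmx1 mul1mx mulmx1 addr0.
Qed.

Lemma eq_tens_map p p' q q' (f f' : 'M[C]_p -> 'M[C]_p') (g g' : 'M[C]_q -> 'M[C]_q') X :
  f =1 f' -> g =1 g' -> tens_map f g X = tens_map f' g' X.
Proof.
move=> hf hg; do 4 (apply: eq_bigr => ? _).
by rewrite hf hg.
Qed.

Lemma kraus_linear (I : finType) p q (A : I -> 'M[C]_(q, p)) : linear (kraus A).
Proof.
move=> a X Y; rewrite /kraus scaler_sumr -big_split; apply: eq_bigr => k _ /=.
by rewrite mulmxDr mulmxDl -scalemxAr -scalemxAl.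
Qed.

Lemma psd_kraus (I : finType) p q (A : I -> 'M[C]_(q, p)) (X : 'M[C]_p) :
  psd X -> psd (kraus A X).
Proof.
move=> hX; apply: psd_sum => k.
by have := psd_congr ((A k)^t*) hX; rewrite trmxCK.
Qed.

Lemma trace_kraus (I : finType) p q (A : I -> 'M[C]_(q, p)) (X : 'M[C]_p) :
  \sum_k (A k)^t* *m A k = 1%:M -> \tr (kraus A X) = \tr X.
Proof.
move=> hA; rewrite raddf_sum -[X in RHS]mul1mx -hA mulmx_suml raddf_sum.
by apply: eq_bigr => k _ /=; rewrite mxtrace_mulC !mulmxA.
Qed.

(** For complete positivity the identity is written as a Kraus map with one operator, so that its
    tensor product with [kraus A] is again a Kraus map. *)
Lemma kraus_channel (I : finType) p q (A : I -> 'M[C]_(q, p)) :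
  \sum_k (A k)^t* *m A k = 1%:M -> is_channel (kraus A).
Proof.
move=> hA; split; first exact: kraus_linear.
  move=> k X hX.
  rewrite (@eq_tens_map _ _ _ _ _ (kraus (fun _ : unit => 1%:M)) _ (kraus A)) //.
    by rewrite tens_map_kraus; apply: psd_kraus.
  by move=> Y; rewrite kraus_id.
by move=> X; apply: trace_kraus.
Qed.

Lemma tens_map_tens p p' q q' (f : 'M[C]_p -> 'M[C]_p') (g : 'M[C]_q -> 'M[C]_q') X Y :
  linear f -> linear g -> tens_map f g (X *t Y) = f X *t g Y.
Proof.
move=> lf lg.
have sumf n n' (h : 'M[C]_n -> 'M[C]_n') (Z : 'M[C]_n) : linear h ->
    h Z = \sum_i \sum_j Z i j *: h (delta_mx i j).
  move=> lh; pose hl := GRing.isLinear.Build _ _ _ _ h lh.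
  pose H : {linear 'M[C]_n -> 'M[C]_n'} := HB.pack h hl.
  rewrite {1}[Z]matrix_sum_delta -[h]/(H : _ -> _) linear_sum; apply: eq_bigr => i _.
  by rewrite linear_sum; apply: eq_bigr => j _; rewrite linearZ.
rewrite (sumf _ _ f X) // (sumf _ _ g Y) // tens_suml; apply: eq_bigr => i _.
rewrite tens_suml; apply: eq_bigr => j _; rewrite tensmxZl tens_sumr scaler_sumr.
apply: eq_bigr => k _; rewrite tens_sumr scaler_sumr; apply: eq_bigr => l _.
by rewrite tensmxE tensmxZr scalerA.
Qed.

Lemma psd_tens1 p (Z : 'M[C]_p) : psd ((1%:M : 'M[C]_1) *t Z) -> psd Z.
Proof.
move=> h v; have := psd_congr ((1%:M : 'M[C]_1) *t v) h.
rewrite adjmx_tens adjmx1 !tensmx_mul !mulmx1.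
by move=> /(psd_diag_ge0 (mxtens_index (ord0, ord0))); rewrite tensmxE mxE mul1r.
Qed.

(** Complete positivity with an ancilla of dimension 1. *)
Lemma channel_psd p q (f : 'M[C]_p -> 'M[C]_q) (X : 'M[C]_p) :
  is_channel f -> psd X -> psd (f X).
Proof.
move=> hf hX; apply: psd_tens1.
have p1 : psd (1%:M : 'M[C]_1).
  by rewrite -[1%:M]mulmx1 -{1}adjmx1; apply: psd_gram.
have := channel_cp hf (psd_tens p1 hX); rewrite tens_map_tens //.
exact: channel_linear hf.
Qed.

Lemma quad_le_trace p (Z : 'M[C]_p) (w : 'cV[C]_p) : psd Z -> hsnorm2 w = 1 ->
  (w^t* *m Z *m w) 0 0 <= \tr Z.
Proof.
move=> /psd_factor[Y ->] hw; have ww : w^t* *m w = 1%:M.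
  by rewrite [LHS]mx11_scalar sqnormv hw.
have cw : contraction (w^t*).
  apply: contraction_idem; rewrite trmxCK.
  by rewrite mulmxA -(mulmxA w) ww mulmx1.
have [G hG] := psd_factor cw.
rewrite quad_hsnorm2 -subr_ge0 -hsnorm2_tr.
suff -> : hsnorm2 Y - hsnorm2 (Y *m w) = hsnorm2 (Y *m G^t*) by apply: hsnorm2_ge0.
have hY n (V : 'M[C]_(p, n)) : hsnorm2 (Y *m V) = \tr (Y *m (V *m V^t*) *m Y^t*).
  by rewrite -hsnorm2_adj hsnorm2_tr trmxCK adjmxM !mulmxA.
rewrite !hY trmxCK -hG trmxCK mulmxBr mulmx1 mulmxBl raddfB /=.
by rewrite hsnorm2_tr [in LHS]mxtrace_mulC.
Qed.

Lemma ketbra_psd p (w : 'cV[C]_p) : psd (ketbra w).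
Proof. by rewrite /ketbra -{1}[w]trmxCK; apply: psd_gram. Qed.

(** Serves to bound the sets in [min_fidelity]: a real [sup] dominates its elements only when the
    set is bounded above. *)
Lemma fidelity_le1 p (T D : 'M[C]_p -> 'M[C]_p) (w : 'cV[C]_p) :
  is_channel T -> is_channel D -> unit_vector w ->
  fidelity w (D (T (ketbra w))) <= 1.
Proof.
move=> hT hD hw; have hw' : hsnorm2 w = 1 by rewrite -sqnormv.
have pZ : psd (D (T (ketbra w))).
  by apply: channel_psd => //; apply: channel_psd => //; apply: ketbra_psd.
have := quad_le_trace pZ hw'.
rewrite (channel_tp hD) (channel_tp hT) mxtrace_mulC [X in \tr X]mx11_scalar.
by rewrite mxtrace_scalar hw lecE => /andP[_].
Qed.

(** Includes the empty set, whose [sup] has the default value 0. *)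
Lemma sup_le1 (E : set R) : (forall x, E x -> x <= 1) -> sup E <= 1.
Proof.
move=> h; have [[x Ex]|E0] := pselect (E !=set0).
  by apply: ge_sup => //; exists x.
by rewrite sup_out ?ler01 // => -[].
Qed.

Lemma inf_le1 (E : set R) : (forall x, E x -> x <= 1) -> inf E <= 1.
Proof.
move=> h; have [[[x Ex] lE]|nE] := pselect (has_inf E).
  exact: le_trans (ge_inf lE Ex) (h _ Ex).
by rewrite inf_out ?ler01.
Qed.

(** One code space and one decoder bound both suprema from below, as all competing values are at
    most 1. *)
Lemma min_fidelity_ge p (T D : 'M[C]_p -> 'M[C]_p) (H : {vspace 'cV[C]_p}) m (a : R) :
  is_channel T -> is_decoder H D -> \dim H = m -> (0 < m)%N ->
  (forall w : 'cV[C]_p, w \in H -> unit_vector w ->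
     a <= fidelity w (D (T (ketbra w)))) ->
  a <= min_fidelity T m.
Proof.
move=> hT hD hm m0 ha.
have finf (H' : {vspace 'cV[C]_p}) D' : is_decoder H' D' ->
    inf [set fidelity w (D' (T (ketbra w))) | w in [set w : 'cV[C]_p | w \in H' /\ unit_vector w]] <= 1.
  by move=> hD'; apply: inf_le1 => _ [w [_ hw] <-]; exact: (fidelity_le1 hT (proj1 hD') hw).
have fsup (H' : {vspace 'cV[C]_p}) :
  sup [set inf [set fidelity w (D (T (ketbra w))) |
                    w in [set w : 'cV[C]_p | w \in H' /\ unit_vector w]] |
              D in [set D | is_decoder H' D]] <= 1.
  by apply: sup_le1 => _ [D' hD' <-]; apply: finf.
apply: (@le_trans _ _ (sup [set inf [set fidelity w (D (T (ketbra w))) |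
                    w in [set w : 'cV[C]_p | w \in H /\ unit_vector w]] |
              D in [set D | is_decoder H D]])); last first.
  apply: ub_le_sup; last by exists H.
  by exists 1 => _ [H' _ <-]; apply: fsup.
apply: (@le_trans _ _ (inf [set fidelity w (D (T (ketbra w))) |
                    w in [set w : 'cV[C]_p | w \in H /\ unit_vector w]])); last first.
  apply: ub_le_sup; last by exists D.
  by exists 1 => _ [D' hD' <-]; apply: finf.
apply: lb_le_inf; last by move=> _ [w [wH hw] <-]; apply: ha.
(* A unit vector of [H] is exhibited: over an empty set the infimum would be the default 0 instead
   of being bounded by [a]. *)
have hv : vpick H != 0 by rewrite vpick0 -dimv_eq0 hm -lt0n.
set v := vpick H in hv *.
have nv0 : hsnorm2 v != 0 by apply: contra_neq hv; apply: hsnorm2_eq0.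
have w1 : unit_vector ((sqrtC (hsnorm2 v))^-1 *: v).
  rewrite /unit_vector sqnormv hsnorm2Z normfV ger0_norm ?sqrtC_ge0 ?hsnorm2_ge0 //.
  by rewrite exprVn sqrtCK mulVf.
exists (fidelity ((sqrtC (hsnorm2 v))^-1 *: v) (D (T (ketbra ((sqrtC (hsnorm2 v))^-1 *: v))))).
exists ((sqrtC (hsnorm2 v))^-1 *: v) => //; split => //.
by rewrite rpredZ // memv_pick.
Qed.

End Kraus.

(** * The decoding channel and its fidelity *)

Section Decoder.
Variable R : realType.
Local Notation C := R[i].
Local Open Scope sesquilinear_scope.
Local Open Scope complex_scope.

Definition rowblk K m d (M : 'M[C]_(K * m, d)) (j : 'I_K) : 'M[C]_(m, d) :=
  \matrix_(a, i) M (mxtens_index (j, a)) i.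

Lemma sum_rowblk K m d (M : 'M[C]_(K * m, d)) :
  \sum_j (rowblk M j)^t* *m rowblk M j = M^t* *m M.
Proof.
apply/matrixP => a b; rewrite summxE mxE sum_mxtens_index.
apply: eq_bigr => j _; rewrite mxE; apply: eq_bigr => i _; by rewrite !mxE.
Qed.

Lemma hsnorm2_rowblk K m d (M : 'M[C]_(K * m, d)) (x : 'cV[C]_m) (v : 'cV[C]_d) :
  hsnorm2 (((1%:M : 'M[C]_K) *t x^t*) *m M *m v) =
  \sum_j `|(x^t* *m rowblk M j *m v) 0 0| ^+ 2.
Proof.
rewrite /hsnorm2; under eq_bigr => k _ do rewrite big_ord1.
rewrite sum_mxtens_index; apply: eq_bigr => j _; rewrite big_ord1.
congr (`|_| ^+ 2); rewrite !mxE; apply: eq_bigr => i _; congr (_ * _).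
rewrite !mxE sum_mxtens_index (bigD1 j) //= [X in _ + X]big1 ?addr0 => [|l nl].
  by apply: eq_bigr => a _; rewrite tensmxE [1%:M _ _]mxE eqxx mul1r !mxE.
by rewrite big1 // => a _; rewrite tensmxE [1%:M _ _]mxE eq_sym (negbTE nl) !mul0r.
Qed.

(** The blocks of [Rf] decode into C^m and [W] embeds the result in the code space. Since [Rf] is
    only a contraction, the [inr] operators send the missing weight Z^* Z to the fixed code vector W
    e_i0; all outputs thus lie in the code space. *)
Definition decoder_op K m d (W : 'M[C]_(d, m)) (Rf : 'M[C]_(K * m, d)) (i0 : 'I_m)
    (Z : 'M[C]_d) (c : 'I_K + 'I_d) : 'M[C]_d :=
  match c with
  | inl j => W *m rowblk Rf j
  | inr a => W *m (delta_mx i0 a *m Z)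
  end.

Lemma decoder_op_tp K m d (W : 'M[C]_(d, m)) (Rf : 'M[C]_(K * m, d)) i0 Z :
  W^t* *m W = 1%:M -> 1%:M - Rf^t* *m Rf = Z^t* *m Z ->
  \sum_c (decoder_op W Rf i0 Z c)^t* *m decoder_op W Rf i0 Z c = 1%:M.
Proof.
move=> hW hZ; rewrite big_sumType /=.
have drop n (X : 'M[C]_(m, n)) : (W *m X)^t* *m (W *m X) = X^t* *m X.
  by rewrite adjmxM mulmxA -(mulmxA _ _ W) hW mulmx1.
have -> : \sum_(j < K) (W *m rowblk Rf j)^t* *m (W *m rowblk Rf j) = Rf^t* *m Rf.
  by rewrite -sum_rowblk; apply: eq_bigr => j _; rewrite drop.
have -> : \sum_(a < d) (W *m (delta_mx i0 a *m Z))^t* *m (W *m (delta_mx i0 a *m Z)) =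
    Z^t* *m Z.
  have id1 : (1%:M : 'M[C]_d) = \sum_(a < d) delta_mx a a.
    apply/matrixP => i j; rewrite summxE (bigD1 i) //= big1 ?addr0 => [|a na].
      by rewrite !mxE eqxx eq_sym.
    by rewrite mxE eq_sym (negbTE na).
  rewrite -[X in _ = _ *m X](mul1mx Z) id1.
  rewrite mulmx_suml mulmx_sumr; apply: eq_bigr => a _; rewrite drop.
  rewrite adjmxM adjmx_delta mulmxA -(mulmxA _ (delta_mx a i0)) mul_delta_mx.
  by rewrite !mulmxA.
by rewrite -hZ addrC subrK.
Qed.

(** The code space is the range of [W]. The fidelity at a code vector w is the sum of the |w^* D_c
    A_k w|^2 over the Kraus operators D_c of the decoder and A_k of the channel. *)
Theorem min_fidelity_kraus K d m (A : 'I_K -> 'M[C]_d) (r : 'I_K -> C) (H : 'M[C]_d)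
    (T : 'M[C]_d -> 'M[C]_d) (e : R) :
  T =1 kraus A ->
  (0 < d)%N -> (0 < m)%N -> 0 < e -> e <= 2 ->
  \sum_k (A k)^t* *m A k = 1%:M ->
  (forall k, 0 <= r k) -> \sum_k r k ^+ 2 = 1 -> (forall k, r k = 0 -> A k = 0) ->
  H^t* *m H = 1%:M -> (forall i j, `|H i j| ^+ 2 = d%:R^-1) ->
  128 * m%:R * \sum_k \sum_l (r k * r l)^-1 * hsnorm2 ((A k)^t* *m A l)
    <= e%:C ^+ 2 * d%:R ^+ 2 ->
  1 - e <= min_fidelity T m.
Proof.
move=> /funext -> d0 m0 e0 e2 hA r0 r1 hr hH hflat hS.
have e0' : (0 : C) < e%:C by rewrite (_ : 0 = 0%:C) // ltcR.
have e2' : e%:C <= (2 : C).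
  by rewrite -(rmorph_nat (real_complex R)) lecR.
have [W [Rf [hW cRf hfid]]] := kraus_code d0 m0 e0' e2' hA r0 r1 hr hH hflat hS.
have [Z hZ] := psd_factor cRf.
pose i0 := Ordinal m0.
pose lW : 'Hom('cV[C]_m, 'cV[C]_d) := linfun (mulmx W).
have lWE x : lW x = W *m x by rewrite lfunE.
pose Hs : {vspace 'cV[C]_d} := limg lW.
have hDop X : kraus (decoder_op W Rf i0 Z) X =
    W *m (\sum_c (match c with inl j => rowblk Rf j | inr a => delta_mx i0 a *m Z end) *m
      X *m (decoder_op W Rf i0 Z c)^t*).
  rewrite /kraus mulmx_sumr; apply: eq_bigr => -[j|a] _ /=; by rewrite !mulmxA.
apply: (@min_fidelity_ge _ _ _ (kraus (decoder_op W Rf i0 Z)) Hs).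
- exact: kraus_channel.
- split; first by apply: kraus_channel; apply: decoder_op_tp.
  by move=> X u; rewrite hDop -mulmxA -lWE memv_img ?memvf.
- have /eqP ker0 : lker lW == 0%VS.
    apply/lker0P => x y; rewrite !lWE => /(congr1 (mulmx (W^t*))).
    by rewrite !mulmxA hW !mul1mx.
  by rewrite limg_dim_eq ?ker0 ?capv0 // dimvf /dim /= muln1.
- by [].
move=> _ /memv_imgP[x _ ->]; rewrite lWE => /[dup] hw.
rewrite /unit_vector sqnormv hsnorm2_isometryl // => hx.
rewrite -lecR rmorphB rmorph1.
have -> : (fidelity (W *m x) (kraus (decoder_op W Rf i0 Z) (kraus A (ketbra (W *m x)))))%:C =
  \sum_c \sum_k `|((W *m x)^t* *m (decoder_op W Rf i0 Z c) *m (A k *m (W *m x))) 0 0| ^+ 2.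
  move: (W *m x) => w.
  have q : ((w^t* *m (kraus (decoder_op W Rf i0 Z) (kraus A (ketbra w))) *m w) 0 0) =
    \sum_c \sum_k `|(w^t* *m (decoder_op W Rf i0 Z c) *m (A k *m w)) 0 0| ^+ 2.
    rewrite {1}/kraus mulmx_sumr mulmx_suml summxE; apply: eq_bigr => c _.
    rewrite /kraus mulmx_sumr mulmx_suml mulmx_sumr mulmx_suml summxE.
    apply: eq_bigr => k _; set D := decoder_op _ _ _ _ _.
    rewrite normCK -(adjmxE (w^t* *m D *m (A k *m w))) !adjmxM trmxCK /ketbra.
    have -> : w^t* *m (D *m (A k *m (w *m w^t*) *m (A k)^t*) *m D^t*) *m w =
        (w^t* *m D *m (A k *m w)) *m (w^t* *m (A k)^t* *m (D^t* *m w)).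
      by rewrite !mulmxA.
    by rewrite mxE big_ord1.
  rewrite /fidelity RRe_real q // ger0_real //.
  by apply: sumr_ge0 => c _; apply: sumr_ge0 => k _; rewrite exprn_ge0.
apply: (le_trans (hfid x hx)); rewrite big_sumType /=.
(* The completing operators [inr] only add to the fidelity and are dropped. *)
apply: (@le_trans _ _ (\sum_(j < K) \sum_k
   `|((W *m x)^t* *m (W *m rowblk Rf j) *m (A k *m (W *m x))) 0 0| ^+ 2)); last first.
  rewrite lerDl; apply: sumr_ge0 => c _; apply: sumr_ge0 => k _; by rewrite exprn_ge0.
rewrite le_eqVlt; apply/orP; left; apply/eqP; rewrite [RHS]exchange_big.
apply: eq_bigr => k _; rewrite hsnorm2_rowblk; apply: eq_bigr => j _.
by congr (`|_ 0 0| ^+ 2); rewrite adjmxM !mulmxA -(mulmxA (x^t*) _ W) hW mulmx1.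
Qed.

End Decoder.

(** * Tensor powers *)

Section TensorPower.
Variable R : realType.
Local Notation C := R[i].
Local Open Scope sesquilinear_scope.

Lemma hsnorm2_tens m n p q (A : 'M[C]_(m, n)) (B : 'M[C]_(p, q)) :
  hsnorm2 (A *t B) = hsnorm2 A * hsnorm2 B.
Proof.
rewrite /hsnorm2 sum_mxtens_index mulr_suml.
apply: eq_bigr => i _; rewrite mulr_sumr; apply: eq_bigr => k _.
rewrite sum_mxtens_index mulr_suml.
apply: eq_bigr => j _; rewrite mulr_sumr; apply: eq_bigr => l _.
by rewrite tensmxE normrM exprMn.
Qed.

Fixpoint kraus_pow K d (A : 'I_K -> 'M[C]_d) n : 'I_(dimpow K n) -> 'M[C]_(dimpow d n) :=
  match n with
  | 0 => fun _ => 1%:M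
  | n'.+1 => fun k => A (mxtens_unindex k).1 *t @kraus_pow K d A n' (mxtens_unindex k).2
  end.

Fixpoint weight_pow K (r : 'I_K -> C) n : 'I_(dimpow K n) -> C :=
  match n with
  | 0 => fun _ => 1
  | n'.+1 => fun k => r (mxtens_unindex k).1 * @weight_pow K r n' (mxtens_unindex k).2
  end.

Lemma kraus_powS K d (A : 'I_K -> 'M[C]_d) n i j :
  @kraus_pow K d A n.+1 (mxtens_index (i, j)) = A i *t kraus_pow A j.
Proof.
by rewrite -[LHS]/(A (mxtens_unindex _).1 *t kraus_pow A (mxtens_unindex _).2) mxtens_indexK.
Qed.

Lemma weight_powS K (r : 'I_K -> C) n i j :
  @weight_pow K r n.+1 (mxtens_index (i, j)) = r i * weight_pow r j.
Proof.
by rewrite -[LHS]/(r (mxtens_unindex _).1 * weight_pow r (mxtens_unindex _).2) mxtens_indexK.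
Qed.

Lemma channel_pow_kraus K d (A : 'I_K -> 'M[C]_d) f n : f =1 kraus A ->
  @channel_pow R d f n =1 kraus (@kraus_pow K d A n).
Proof.
move=> hf; elim: n => [|n IH] X.
  rewrite /kraus (bigD1 ord0) //= big1 => [|i]; last by rewrite ord1.
  by rewrite adjmx1 mul1mx mulmx1 addr0.
rewrite [LHS](eq_tens_map _ hf IH) tens_map_kraus /kraus sum_mxtens_index pair_bigA.
by apply: eq_bigr => -[i j] _; rewrite kraus_powS.
Qed.

Lemma kraus_pow_tp K d (A : 'I_K -> 'M[C]_d) n :
  \sum_k (A k)^t* *m A k = 1%:M ->
  \sum_k (@kraus_pow K d A n k)^t* *m @kraus_pow K d A n k = 1%:M.
Proof.
move=> hA; elim: n => [|n IH].
  rewrite (bigD1 ord0) //= big1 => [|i]; last by rewrite ord1.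
  by rewrite adjmx1 mul1mx addr0.
rewrite sum_mxtens_index -tens1mx1 -[in RHS]hA -[in RHS]IH tens_suml.
apply: eq_bigr => i _; rewrite tens_sumr; apply: eq_bigr => j _.
by rewrite kraus_powS adjmx_tens tensmx_mul.
Qed.

Lemma weight_pow_ge0 K (r : 'I_K -> C) n k :
  (forall i, 0 <= r i) -> 0 <= @weight_pow K r n k.
Proof.
move=> r0; elim: n k => [|n IH] k /=; first exact: ler01.
exact: mulr_ge0.
Qed.

Lemma weight_pow_sum K (r : 'I_K -> C) n :
  \sum_k r k ^+ 2 = 1 -> \sum_k @weight_pow K r n k ^+ 2 = 1.
Proof.
move=> r1; elim: n => [|n IH].
  rewrite (bigD1 ord0) //= big1 => [|i]; last by rewrite ord1.
  by rewrite expr1n addr0.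
transitivity ((\sum_k r k ^+ 2) * \sum_k @weight_pow K r n k ^+ 2); last first.
  by rewrite r1 IH mul1r.
rewrite sum_mxtens_index mulr_suml; apply: eq_bigr => i _; rewrite mulr_sumr.
by apply: eq_bigr => j _; rewrite weight_powS exprMn.
Qed.

Lemma kraus_pow_eq0 K d (A : 'I_K -> 'M[C]_d) (r : 'I_K -> C) n k :
  (forall i, r i = 0 -> A i = 0) ->
  @weight_pow K r n k = 0 -> @kraus_pow K d A n k = 0.
Proof.
move=> hr; elim: n k => [|n IH] k /=; first by move=> /eqP; rewrite oner_eq0.
move=> /eqP; rewrite mulf_eq0 => /orP[/eqP/hr ->|/eqP/IH ->].
  by rewrite tens0mx.
by rewrite tensmx0.
Qed.

(** For one use of the probe channel, with [A] and [r] taken from the eigenbasis of sigma_F, this is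
    4 times 2^D_2, as [renyi_kraus] shows. *)
Definition overlap_sum K d (A : 'I_K -> 'M[C]_d) (r : 'I_K -> C) : C :=
  \sum_k \sum_l (r k * r l)^-1 * hsnorm2 ((A k)^t* *m A l).

(** Additivity of D_2 on product states, in Kraus form: weights and Hilbert-Schmidt norms are
    multiplicative under tensor products. *)
Lemma overlap_sum_pow K d (A : 'I_K -> 'M[C]_d) (r : 'I_K -> C) n :
  overlap_sum (@kraus_pow K d A n) (@weight_pow K r n) = overlap_sum A r ^+ n.
Proof.
elim: n => [|n IH].
  rewrite /overlap_sum /= !big_ord1 adjmx1 mul1mx /hsnorm2 !big_ord1 mxE eqxx.
  by rewrite normr1 expr1n mulr1 invr1 mulr1 expr0.
rewrite exprS -IH /overlap_sum sum_mxtens_index mulr_suml.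
apply: eq_bigr => i _; rewrite mulr_sumr; apply: eq_bigr => k _.
rewrite sum_mxtens_index mulr_suml.
apply: eq_bigr => j _; rewrite mulr_sumr; apply: eq_bigr => l _.
rewrite !weight_powS !kraus_powS adjmx_tens tensmx_mul hsnorm2_tens.
by rewrite [X in X^-1]mulrACA invfM mulrACA.
Qed.

(** Tensor powers of the 2 x 2 Hadamard matrix: unitarity and flatness pass to tensor products. *)
Lemma hadamard_exists n : exists2 H : 'M[C]_(dimpow 2 n),
  H^t* *m H = 1%:M & forall i j, `|H i j| ^+ 2 = (dimpow 2 n)%:R^-1.
Proof.
elim: n => [|n [H hH hflat]].
  exists 1%:M; first by rewrite adjmx1 mul1mx.
  by move=> i j; rewrite !ord1 mxE eqxx normr1 expr1n invr1.
pose h (i j : 'I_2) : C := if (i == 1) && (j == 1) then -1 else 1.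
pose H1 : 'M[C]_2 := \matrix_(i, j) (h i j / sqrtC 2).
have s2 : (sqrtC 2 : C) * sqrtC 2 = 2 by rewrite -expr2 sqrtCK.
have s0 : (sqrtC 2 : C) != 0 by rewrite sqrtC_eq0 pnatr_eq0.
have sc : ((sqrtC 2 : C))^* = sqrtC 2.
  by apply/CrealP/ger0_real; rewrite sqrtC_ge0 ler0n.
have H1H : H1^t* *m H1 = 1%:M.
  have two0 : (2 : C) != 0 by rewrite pnatr_eq0.
  apply/matrixP => i j; rewrite mxE !big_ord_recl big_ord0 !mxE.
  rewrite !rmorphM !fmorphV /= sc /h.
  case: i j => [[|[|//]] hi] [[|[|//]] hj] /=;
    rewrite ?rmorphN ?rmorph1 ?(mulr1n, mulr0n);
    by field: s2; rewrite ?s0.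
exists (H1 *t H); first by rewrite adjmx_tens tensmx_mul H1H hH tens1mx1.
move=> i j; case: (mxtens_indexP i) => a b; case: (mxtens_indexP j) => c e.
rewrite tensmxE normrM exprMn hflat mxE normrM exprMn normfV exprVn.
have q0 : 0 <= sqrtC (2 : C) by rewrite sqrtC_ge0 ler0n.
rewrite (ger0_norm q0) sqrtCK /h natrM invfM; congr (_ * _).
by case: ifP => _; rewrite ?normrN normr1 expr1n mul1r.
Qed.

End TensorPower.

(** * The probe channel and its Renyi entropy *)

Section ProbeChannel.
Variable R : realType.
Local Notation C := R[i].
Local Open Scope sesquilinear_scope.

Lemma Ualpha_unitary (ax ay az : R) : (Ualpha ax ay az)^t* *m Ualpha ax ay az = 1%:M.
Proof.
have h1 := cos2Dsin2 ((ax - ay) / 2); have h2 := cos2Dsin2 ((ax + ay) / 2).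
have h3 := cos2Dsin2 az.
apply/matrixP => i j; rewrite mxE !big_ord_recl big_ord0 !mxE.
case: i j => [[|[|[|[|//]]]] hi] [[|[|[|[|//]]]] hj] /=;
  apply/eqP; rewrite eq_complex /=; apply/andP; split; apply/eqP; nra.
Qed.

(** The operator <k|_F U |v>_A from E to B. *)
Definition probe_kraus (U : 'M[C]_(2 * 2)) (v : 'cV[C]_2) (k : 'I_2) : 'M[C]_2 :=
  \matrix_(x, e) \sum_a U (mxtens_index (x, k)) (mxtens_index (a, e)) * v a 0.

Lemma evolve_probe U (v : 'cV[C]_2) (theta : 'M[C]_2) x k y l :
  evolve U (ketbra v) theta (mxtens_index (x, k)) (mxtens_index (y, l)) =
  (probe_kraus U v k *m theta *m (probe_kraus U v l)^t*) x y.
Proof.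
rewrite /evolve /ketbra mxE sum_mxtens_index.
transitivity (\sum_a \sum_e \sum_b \sum_f U (mxtens_index (x, k)) (mxtens_index (b, f)) *
  (v b 0 * (v a 0)^* * theta f e) * (U (mxtens_index (y, l)) (mxtens_index (a, e)))^*).
  apply: eq_bigr => a _; apply: eq_bigr => e _.
  rewrite mxE sum_mxtens_index mulr_suml; apply: eq_bigr => b _.
  rewrite mulr_suml; apply: eq_bigr => f _.
  by rewrite tensmxE !mxE big_ord1 !mxE.
rewrite mxE exchange_big; apply: eq_bigr => e _.
rewrite !mxE rmorph_sum mulr_sumr; apply: eq_bigr => a _.
rewrite mulr_suml exchange_big; apply: eq_bigr => f _ /=.
rewrite mxE !mulr_suml; apply: eq_bigr => b _; rewrite rmorphM /=; ring.
Qed.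

Lemma Nchan_kraus U (v : 'cV[C]_2) : Nchan U (ketbra v) =1 kraus (probe_kraus U v).
Proof.
move=> theta; apply/matrixP => x y; rewrite mxE summxE.
by apply: eq_bigr => k _; rewrite evolve_probe.
Qed.

(** The link between [rhoBF], defined by the complementary channel, and the Kraus operators of the
    channel to be coded. *)
Lemma Ncompl_entry U (v : 'cV[C]_2) theta k l :
  Ncompl U (ketbra v) theta k l =
  \tr (probe_kraus U v k *m theta *m (probe_kraus U v l)^t*).
Proof. by rewrite mxE; apply: eq_bigr => x _; rewrite evolve_probe. Qed.

Lemma probe_kraus_tp U (v : 'cV[C]_2) : U^t* *m U = 1%:M -> unit_vector v ->
  \sum_k (probe_kraus U v k)^t* *m probe_kraus U v k = 1%:M.
Proof.
move=> hU hv; apply/matrixP => e f; rewrite summxE.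
have hUe a b : \sum_x \sum_k (U (mxtens_index (x, k)) (mxtens_index (a, e)))^* *
    U (mxtens_index (x, k)) (mxtens_index (b, f)) = ((a == b) && (e == f))%:R.
  have /matrixP/(_ (mxtens_index (a, e)) (mxtens_index (b, f))) := hU.
  rewrite !mxE sum_mxtens_index (can_eq (@mxtens_indexK 2 2)) xpair_eqE => <-.
  by apply: eq_bigr => x _; apply: eq_bigr => k _; rewrite !mxE.
transitivity (\sum_a \sum_b (v a 0)^* * v b 0 *
   \sum_x \sum_k (U (mxtens_index (x, k)) (mxtens_index (a, e)))^* *
    U (mxtens_index (x, k)) (mxtens_index (b, f))).
  transitivity (\sum_k \sum_x \sum_a \sum_b (v a 0)^* * v b 0 *
     ((U (mxtens_index (x, k)) (mxtens_index (a, e)))^* *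
    U (mxtens_index (x, k)) (mxtens_index (b, f)))).
    apply: eq_bigr => k _; rewrite mxE; apply: eq_bigr => x _.
    rewrite !mxE rmorph_sum mulr_suml; apply: eq_bigr => a _.
    by rewrite mulr_sumr; apply: eq_bigr => b _; rewrite rmorphM /=; ring.
  rewrite exchange_big.
  under eq_bigr => x _ do rewrite exchange_big.
  rewrite exchange_big; apply: eq_bigr => a _.
  under eq_bigr => x _ do rewrite exchange_big.
  rewrite exchange_big; apply: eq_bigr => b _.
  by rewrite mulr_sumr; apply: eq_bigr => x _; rewrite mulr_sumr.
transitivity (\sum_a (v a 0)^* * v a 0 * (e == f)%:R).
  apply: eq_bigr => a _; rewrite (bigD1 a) //= [X in _ + X]big1 ?addr0 => [|b nb].
    by rewrite hUe eqxx.
  by rewrite hUe eq_sym (negbTE nb) mulr0.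
rewrite -mulr_suml [1%:M _ _]mxE.
have -> : \sum_i (v i 0)^* * v i 0 = 1.
  by rewrite -hv mxE; apply: eq_bigr => i _; rewrite !mxE.
by rewrite mul1r.
Qed.

(** A change of basis of the environment F. It leaves the channel unchanged and will be used with
    the unitary that diagonalizes sigma_F. *)
Definition mix_kraus p q d (V : 'M[C]_(p, q)) (A : 'I_q -> 'M[C]_d) (k : 'I_p) : 'M[C]_d :=
  \sum_l V k l *: A l.

Lemma isometry_entry p q (V : 'M[C]_(p, q)) l l' : V^t* *m V = 1%:M ->
  \sum_k (V k l)^* * V k l' = (l == l')%:R.
Proof.
move=> /matrixP/(_ l l'); rewrite !mxE => <-.
by apply: eq_bigr => k _; rewrite !mxE.
Qed.

Lemma mix_kraus_eq p q d (V : 'M[C]_(p, q)) (A : 'I_q -> 'M[C]_d) :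
  V^t* *m V = 1%:M -> kraus (mix_kraus V A) =1 kraus A.
Proof.
move=> hV X; rewrite /kraus /mix_kraus.
transitivity (\sum_l \sum_l' (\sum_k (V k l')^* * V k l) *: (A l *m X *m (A l')^t*)).
  transitivity (\sum_k \sum_l \sum_l' ((V k l')^* * V k l) *: (A l *m X *m (A l')^t*)).
    apply: eq_bigr => k _; rewrite 2!mulmx_suml; apply: eq_bigr => l _.
    rewrite (_ : (\sum_l' V k l' *: A l')^t* = \sum_l' (V k l')^* *: (A l')^t*).
      rewrite mulmx_sumr; apply: eq_bigr => l' _.
      by rewrite -!scalemxAl -scalemxAr scalerA mulrC.
    elim/big_rec2: _ => [|i Y Z _ <-]; last by rewrite adjmxD adjmxZ.
    by apply/matrixP => i j; rewrite !mxE rmorph0.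
  rewrite exchange_big; apply: eq_bigr => l _; rewrite exchange_big.
  by apply: eq_bigr => l' _; rewrite scaler_suml.
apply: eq_bigr => l _; rewrite (bigD1 l) //= [X in _ + X]big1 ?addr0 => [|l' nl].
  by rewrite isometry_entry // eqxx scale1r.
by rewrite isometry_entry // (negbTE nl) scale0r.
Qed.

Lemma mix_kraus_tp p q d (V : 'M[C]_(p, q)) (A : 'I_q -> 'M[C]_d) :
  V^t* *m V = 1%:M -> \sum_k (A k)^t* *m A k = 1%:M ->
  \sum_k (mix_kraus V A k)^t* *m mix_kraus V A k = 1%:M.
Proof.
move=> hV hA.
have h (B : 'I_q -> 'M[C]_d) (W : 'M[C]_(p, q)) k :
    (mix_kraus W B k)^t* = \sum_l (W k l)^* *: (B l)^t*.
  rewrite /mix_kraus; elim/big_rec2: _ => [|i Y Z _ <-]; last by rewrite adjmxD adjmxZ.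
  by apply/matrixP => i j; rewrite !mxE rmorph0.
transitivity (\sum_l \sum_l' (\sum_k (V k l)^* * V k l') *: ((A l)^t* *m A l')).
  transitivity (\sum_k \sum_l \sum_l' ((V k l)^* * V k l') *: ((A l)^t* *m A l')).
    apply: eq_bigr => k _; rewrite h mulmx_suml; apply: eq_bigr => l _.
    rewrite mulmx_sumr; apply: eq_bigr => l' _.
    by rewrite -!scalemxAl -scalemxAr scalerA.
  rewrite exchange_big; apply: eq_bigr => l _; rewrite exchange_big.
  by apply: eq_bigr => l' _; rewrite scaler_suml.
rewrite -hA; apply: eq_bigr => l _; rewrite (bigD1 l) //= [X in _ + X]big1 ?addr0 => [|l' nl].
  by rewrite isometry_entry // eqxx scale1r.
by rewrite isometry_entry // eq_sym (negbTE nl) scale0r.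
Qed.

End ProbeChannel.

(** * The order-2 divergence in terms of Kraus operators *)

Section RenyiFormula.
Variable R : realType.
Local Notation C := R[i].
Local Open Scope sesquilinear_scope.

Lemma diag_intertwine p (Q : 'M[C]_p) (s l : 'rV[C]_p) (f : C -> C) :
  diag_mx s *m Q = Q *m diag_mx l ->
  diag_mx (map_mx f s) *m Q = Q *m diag_mx (map_mx f l).
Proof.
move=> QE; apply/matrixP => i j; rewrite mul_diag_mx mul_mx_diag !mxE.
have /matrixP/(_ i j) := QE; rewrite mul_diag_mx mul_mx_diag !mxE [RHS]mulrC => e.
have [->|nz] := eqVneq (Q i j) 0; first by rewrite mulr0 mul0r.
by move: (mulIf nz e) => ->; rewrite mulrC.
Qed.

(* [spectralmx A] and any other diagonalizing unitary [U] are intertwined by a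
   matrix that only links equal eigenvalues. *)
Lemma mxpower_diag p (A U : 'M[C]_p) (l : 'rV[C]_p) (a : R) :
  U *m U^t* = 1%:M -> (forall i, l 0 i \is Num.real) ->
  A = U^t* *m diag_mx l *m U ->
  mxpower A a = U^t* *m diag_mx (map_mx (fun x : C => ((complex.Re x `^ a)%:C)%C) l) *m U.
Proof.
move=> hU lR hA.
have hAh : A^t* = A by rewrite hA adj_conj_diag.
have hh : A \is hermsymmx.
  by apply/is_hermitianmxP; rewrite expr0 scale1r hAh.
rewrite /mxpower; set P := spectralmx A; set s := spectral_diag A.
have uP : P \is unitarymx := spectral_unitarymx A.
have PP : P *m P^t* = 1%:M by apply/unitarymxP.
have PA : A = P^t* *m diag_mx s *m P.
  by rewrite -invmx_unitary //; apply/orthomx_spectralP/hermitian_normalmx.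
have -> : invmx P = P^t* := invmx_unitary uP.
set f := fun x : C => _.
pose Q := P *m U^t*.
have QE : diag_mx s *m Q = Q *m diag_mx l.
  rewrite -(diag_conj_unitary PP PA) -(diag_conj_unitary hU hA) /Q !mulmxA.
  by rewrite -(mulmxA _ (P^t*)) (mulmx1C PP) mulmx1 -(mulmxA P (U^t*)) (mulmx1C hU) mulmx1.
have fQ : diag_mx (map_mx f s) *m Q = Q *m diag_mx (map_mx f l).
  exact: diag_intertwine.
have PQ : P = Q *m U by rewrite /Q -mulmxA (mulmx1C hU) mulmx1.
have QQ : Q^t* *m Q = 1%:M.
  by rewrite /Q adjmxM trmxCK mulmxA -(mulmxA U) (mulmx1C PP) mulmx1.
clearbody Q; rewrite PQ adjmxM -mulmxA [diag_mx _ *m _]mulmxA fQ !mulmxA.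
by rewrite -!mulmxA [Q^t* *m (Q *m _)]mulmxA QQ mul1mx.
Qed.

(* [rhoBF] is [Z *m Z^t*] for this [Z], with [Psi] the coefficient matrix of the
   maximally entangled vector. *)
Definition choi_factor (A : 'I_2 -> 'M[C]_2) (Psi : 'M[C]_2) : 'M[C]_(2 * 2, 2) :=
  \matrix_(I, x) (A (mxtens_unindex I).2 *m Psi^T) x (mxtens_unindex I).1.

Lemma choi_factorE A Psi b k x :
  choi_factor A Psi (mxtens_index (b, k)) x = (A k *m Psi^T) x b.
Proof. by rewrite mxE mxtens_indexK. Qed.

Lemma tr_delta_sandwich d (A B : 'M[C]_d) e f :
  \tr (A *m delta_mx e f *m B^t*) = \sum_x A x e * (B x f)^*.
Proof.
rewrite -(mul_delta_mx (0 : 'I_1)) mulmxA -mulmxA -colE -rowE.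
by apply: eq_bigr => x _; rewrite !mxE big_ord1 !mxE.
Qed.

Lemma rhoBF_choi U (v : 'cV[C]_2) (w : 'cV[C]_(2 * 2))
    (Psi := \matrix_(b < 2, e < 2) w (mxtens_index (b, e)) 0) :
  rhoBF U (ketbra v) (ketbra w) =
  choi_factor (probe_kraus U v) Psi *m (choi_factor (probe_kraus U v) Psi)^t*.
Proof.
set A := probe_kraus U v.
apply/matrixP => I J; case: (mxtens_indexP I) => b k; case: (mxtens_indexP J) => c l.
transitivity (\sum_e \sum_f Psi b e * (Psi c f)^* *
    \tr (A k *m delta_mx e f *m (A l)^t*)).
  rewrite /rhoBF /tens_map summxE (bigD1 b) //= [X in _ + X]big1 ?addr0 => [|i ni].
    rewrite summxE (bigD1 c) //= [X in _ + X]big1 ?addr0 => [|i ni].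
      rewrite summxE; apply: eq_bigr => e _; rewrite summxE; apply: eq_bigr => f _.
      rewrite mxE tensmxE Ncompl_entry /ketbra !mxE big_ord1 !mxE !eqxx mul1r.
      by [].
    rewrite !summxE big1 // => e _; rewrite summxE big1 // => f _.
    by rewrite mxE tensmxE !mxE (eq_sym c) (negbTE ni) andbF mul0r mulr0.
  rewrite !summxE big1 // => j _; rewrite summxE big1 // => e _.
  rewrite summxE big1 // => f _.
  by rewrite mxE tensmxE !mxE (eq_sym b) (negbTE ni) mul0r mulr0.
rewrite mxE; transitivity (\sum_x \sum_e \sum_f Psi b e * (Psi c f)^* *
   (A k x e * (A l x f)^*)).
  rewrite [RHS]exchange_big; apply: eq_bigr => e _; rewrite [RHS]exchange_big.
  apply: eq_bigr => f _; rewrite -mulr_sumr; congr (_ * _); exact: tr_delta_sandwich.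
apply: eq_bigr => x _; rewrite adjmxE !choi_factorE !mxE rmorph_sum mulr_suml.
apply: eq_bigr => e _; rewrite mulr_sumr; apply: eq_bigr => f _.
by rewrite !mxE rmorphM /=; ring.
Qed.

Lemma choi_factor_mix V A Psi :
  ((1%:M : 'M[C]_2) *t V) *m choi_factor A Psi = choi_factor (mix_kraus V A) Psi.
Proof.
apply/matrixP => I x; case: (mxtens_indexP I) => b k.
rewrite choi_factorE mxE sum_mxtens_index (bigD1 b) //= [X in _ + X]big1 ?addr0.
  rewrite /mix_kraus mulmx_suml summxE; apply: eq_bigr => l _.
  by rewrite tensmxE choi_factorE [1%:M _ _]mxE eqxx mul1r -scalemxAl [RHS]mxE.
move=> c nc; rewrite big1 // => l _.
by rewrite tensmxE [1%:M _ _]mxE eq_sym (negbTE nc) !mul0r.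
Qed.

Lemma choi_gram_entry A Psi b k c l :
  (choi_factor A Psi *m (choi_factor A Psi)^t*) (mxtens_index (b, k)) (mxtens_index (c, l)) =
  ((Psi^T)^t* *m ((A l)^t* *m A k) *m Psi^T) c b.
Proof.
have -> : (Psi^T)^t* *m ((A l)^t* *m A k) *m Psi^T = (A l *m Psi^T)^t* *m (A k *m Psi^T).
  by rewrite adjmxM !mulmxA.
rewrite !mxE; apply: eq_bigr => x _.
by rewrite !adjmxE !choi_factorE mulrC.
Qed.

(** [Y] is a unitary divided by the square root of 2, so each of its two occurrences halves the
    squared norm. *)
Lemma hsnorm2_max_entangled (Y M : 'M[C]_2) : Y *m Y^t* = (2^-1)%:M ->
  hsnorm2 (Y^t* *m M *m Y) = hsnorm2 M / 4.
Proof.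
move=> hY.
have hr n (N : 'M[C]_(n, 2)) : hsnorm2 (N *m Y) = 2^-1 * hsnorm2 N.
  rewrite -hsnorm2_adj hsnorm2_tr trmxCK adjmxM mulmxA -(mulmxA N) hY.
  by rewrite mul_mx_scalar -scalemxAl mxtraceZ -hsnorm2_adj hsnorm2_tr trmxCK.
rewrite hr -hsnorm2_adj adjmxM trmxCK hr hsnorm2_adj.
by field.
Qed.

End RenyiFormula.

Section RenyiKraus.
Variable R : realType.
Local Notation C := R[i].
Local Open Scope sesquilinear_scope.

(** The factor sigma^(-1/4) contributes the square of its eigenvalue to a squared norm, which is the
    weight 1 / r_k for r_k the root of the eigenvalue of sigma. At 0 both sides take the value 0. *)
Lemma powR_quarter (x : C) : 0 <= x ->
  ((complex.Re x `^ (- 4^-1))%:C)%C ^+ 2 = (sqrtC x)^-1 :> C.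
Proof.
move=> x0; have xR : x = ((complex.Re x)%:C)%C by rewrite RRe_real // ger0_real.
set y := complex.Re x in xR *.
have y0 : 0 <= y by move: x0; rewrite xR (_ : 0 = (0%:C)%C) // lecR.
have [y00|yp] := eqVneq y 0.
  rewrite xR y00 powR0; last by rewrite oppr_eq0 invr_eq0 pnatr_eq0.
  by rewrite expr0n /= rootC0 invr0.
have yp' : 0 < y by rewrite lt_neqAle eq_sym yp.
set u := y `^ (- 4^-1).
have u0 : 0 < u by rewrite powR_gt0.
have u4 : y = (u^-1) ^+ 4.
  rewrite /u -powRN opprK -powR_mulrn ?powR_ge0 // -powRrM mulVf ?pnatr_eq0 //.
  by rewrite powRr1.
have -> : x = ((((u^-1) ^+ 2)%:C)%C : C) ^+ 2 by rewrite xR {1}u4 -rmorphXn /= -exprM.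
rewrite sqrCK ?ler0c ?exprn_ge0 ?invr_ge0 ?(ltW u0) //.
by rewrite -rmorphXn -fmorphV exprVn invrK.
Qed.

Lemma tens_diag1 p q (s : 'rV[C]_q) :
  (1%:M : 'M[C]_p) *t diag_mx s = diag_mx (\row_I s 0 (mxtens_unindex I).2).
Proof.
apply/matrixP => I J; case: (mxtens_indexP I) => b k; case: (mxtens_indexP J) => c l.
rewrite tensmxE !mxE mxtens_indexK (can_eq (@mxtens_indexK p q)) xpair_eqE.
by do 2 case: eqVneq => //= _; rewrite ?mulr1n ?mulr0n ?mul1r ?mul0r ?mulr0.
Qed.

Lemma sum4_swap p q (g : 'I_p -> 'I_p -> 'I_q -> 'I_q -> C) :
  \sum_b \sum_c \sum_k \sum_l g b c k l = \sum_l \sum_k \sum_b \sum_c g b c k l.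
Proof.
rewrite pair_bigA exchange_big [RHS]exchange_big; apply: eq_bigr => k _ /=.
by rewrite exchange_big; apply: eq_bigr => l _; rewrite pair_bigA.
Qed.

Lemma tr_sandwich n k (U D : 'M[C]_n) (Z : 'M[C]_(n, k)) :
  U *m U^t* = 1%:M -> D^t* = D ->
  \tr ((U^t* *m D *m U) *m (Z *m Z^t*) *m (U^t* *m D *m U) *m
       ((U^t* *m D *m U) *m (Z *m Z^t*) *m (U^t* *m D *m U))) =
  hsnorm2 (D *m ((U *m Z) *m (U *m Z)^t*) *m D).
Proof.
move=> UU Da; set N := D *m _ *m D.
have Na : N^t* = N by rewrite /N !adjmxM !trmxCK Da !mulmxA.
have -> : (U^t* *m D *m U) *m (Z *m Z^t*) *m (U^t* *m D *m U) = U^t* *m N *m U.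
  by rewrite /N adjmxM !mulmxA.
rewrite hsnorm2_tr Na -(tr_conj_unitary (N *m N) UU); congr (\tr _).
by rewrite -!mulmxA [U *m (U^t* *m _)]mulmxA UU mul1mx.
Qed.

(** In the eigenbasis of [sigma] the sandwiched operator has blocks indexed by k, l, equal to A_l^*
    A_k between the coefficient matrices of the entangled state and scaled by the two eigenvalues of
    sigma^(-1/4). Maximal entanglement reduces their squared norms to those of A_l^* A_k, up to the
    factor 1/4. *)
Lemma renyi_kraus (U : 'M[C]_(2 * 2)) (v : 'cV[C]_2) (Phi : 'M[C]_(2 * 2)) (sigma : 'M[C]_2) :
  U^t* *m U = 1%:M -> unit_vector v -> max_entangled Phi -> is_state sigma ->
  (rhoBF U (ketbra v) Phi <= (1%:M : 'M[C]_2) *t sigma)%MS ->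
  exists A : 'I_2 -> 'M[C]_2, exists r : 'I_2 -> C,
  [/\ Nchan U (ketbra v) =1 kraus A, \sum_k (A k)^t* *m A k = 1%:M,
      [/\ forall k, 0 <= r k, \sum_k r k ^+ 2 = 1 & forall k, r k = 0 -> A k = 0] &
      D2 (rhoBF U (ketbra v) Phi) ((1%:M : 'M[C]_2) *t sigma) =
      (log2 (complex.Re (overlap_sum A r / 4)))%:E].
Proof.
move=> hU hv [[w hw ->] hPhi _] [psig trsig] hsupp.
pose Psi : 'M[C]_2 := \matrix_(b, e) w (mxtens_index (b, e)) 0.
have hPsi : Psi^T *m (Psi^T)^t* = (2^-1)%:M.
  rewrite -hPhi; apply/matrixP => e f; rewrite !mxE.
  by apply: eq_bigr => b _; rewrite !mxE big_ord1 !mxE.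
have [V [s [VV VV' s0 sigE]]] := psd_spectral psig.
pose A := mix_kraus V (probe_kraus U v).
pose r k := sqrtC (s 0 k).
pose Uh := (1%:M : 'M[C]_2) *t V.
have UU : Uh *m Uh^t* = 1%:M by rewrite adjmx_tens adjmx1 tensmx_mul mulmx1 VV tens1mx1.
pose t : 'rV[C]_(2 * 2) := \row_I s 0 (mxtens_unindex I).2.
have tE b k : t 0 (mxtens_index (b, k)) = s 0 k by rewrite mxE mxtens_indexK.
have tauE : (1%:M : 'M[C]_2) *t sigma = Uh^t* *m diag_mx t *m Uh.
  by rewrite sigE -tens_diag1 adjmx_tens adjmx1 !tensmx_mul !mul1mx.
pose Z := choi_factor (probe_kraus U v) Psi; pose Z' := choi_factor A Psi.
have ZE : Uh *m Z = Z' by apply: choi_factor_mix.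
have rhoE : rhoBF U (ketbra v) (ketbra w) = Z *m Z^t* by apply: rhoBF_choi.
(* By the support condition [Z' *m Z'^t*] factors through the diagonal of eigenvalues, so its
   diagonal entries vanish where the eigenvalue is 0. Hence so do the corresponding rows of [Z'],
   and the invertible [Psi] can be cancelled. *)
have hA0 k : r k = 0 -> A k = 0.
  move=> /eqP; rewrite sqrtC_eq0 => /eqP sk0.
  have [X hX] := submxP hsupp.
  have ZZ : Z' *m Z'^t* = (Uh *m X *m Uh^t*) *m diag_mx t.
    rewrite -ZE adjmxM !mulmxA -[Uh *m Z *m Z^t*]mulmxA -rhoE hX tauE !mulmxA.
    by rewrite -(mulmxA _ Uh (Uh^t*)) UU mulmx1.
  have AY : A k *m Psi^T = 0.
    apply/matrixP => x c; rewrite [RHS]mxE -choi_factorE -/Z'.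
    have : (Z' *m Z'^t*) (mxtens_index (c, k)) (mxtens_index (c, k)) = 0.
      by rewrite ZZ mul_mx_diag mxE tE sk0 mulr0.
    rewrite mxE; under eq_bigr => y _ do rewrite adjmxE -normCK.
    move=> h; have /eqP : `|Z' (mxtens_index (c, k)) x| ^+ 2 = 0.
      by apply: (psumr_eq0P _ h) => // y _; rewrite exprn_ge0.
    by rewrite expf_eq0 normr_eq0 => /eqP.
  have := congr1 (mulmx^~ ((Psi^T)^t*)) AY.
  rewrite /= mul0mx -mulmxA hPsi mul_mx_scalar => /eqP.
  by rewrite scaler_eq0 invr_eq0 pnatr_eq0 /= => /eqP.
exists A, r; split.
- by move=> X; rewrite Nchan_kraus mix_kraus_eq.
- by apply: mix_kraus_tp => //; apply: probe_kraus_tp.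
- split => //; first by move=> k; rewrite sqrtC_ge0.
  rewrite -trsig sigE tr_conj_unitary // mxtrace_diag; apply: eq_bigr => k _.
  by rewrite sqrtCK.
rewrite /D2 hsupp /=; congr ((log2 (complex.Re _))%:E).
pose f := fun x : C => ((complex.Re x `^ (- 4^-1))%:C)%C.
have fR x : f x \is Num.real by rewrite complex_real.
have -> : mxpower (1%:M *t sigma) (- 4^-1) = Uh^t* *m diag_mx (map_mx f t) *m Uh.
  have tR i : t 0 i \is Num.real by rewrite mxE ger0_real.
  exact: (@mxpower_diag R _ _ Uh t (- 4^-1) UU tR tauE).
rewrite rhoE; set Dg := diag_mx (map_mx f t).
have Dga : Dg^t* = Dg by apply: adjmx_diag_real => i; rewrite mxE.
rewrite (tr_sandwich Z UU Dga) ZE.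
have hNe b k c l : (Dg *m (Z' *m Z'^t*) *m Dg) (mxtens_index (b, k)) (mxtens_index (c, l)) =
   f (s 0 k) * ((Psi^T)^t* *m ((A l)^t* *m A k) *m Psi^T) c b * f (s 0 l).
  rewrite mul_mx_diag mxE mul_diag_mx mxE choi_gram_entry.
  by rewrite ![map_mx f t _ _]mxE !tE.
move: (Dg *m (Z' *m Z'^t*) *m Dg) hNe => N hNe.
rewrite {1}/hsnorm2 sum2_mxtens_index sum4_swap /overlap_sum mulr_suml.
have fn k : `|f (s 0 k)| ^+ 2 = (r k)^-1.
  by rewrite ger0_norm ?ler0c ?powR_ge0 // /f powR_quarter.
apply: eq_bigr => l _; rewrite mulr_suml; apply: eq_bigr => k _.
rewrite -mulrA -(hsnorm2_max_entangled _ hPsi) [RHS]mulrC mulr_suml exchange_big.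
apply: eq_bigr => a _; rewrite mulr_suml; apply: eq_bigr => b _.
by rewrite hNe !normrM !exprMn !fn invfM; ring.
Qed.

End RenyiKraus.

(** * The capacity bound *)

Section Capacity.
Variable R : realType.
Local Notation C := R[i].
Local Open Scope sesquilinear_scope.

Lemma ln2_gt0 : 0 < ln 2 :> R.
Proof. by rewrite ln_gt0 // ltr1n. Qed.

Lemma log2_ge0 (x : R) : 1 <= x -> 0 <= log2 x.
Proof. by move=> x1; apply: divr_ge0; [exact: ln_ge0|exact: ltW ln2_gt0]. Qed.

Lemma log2_le (x y : R) : 0 < x -> x <= y -> log2 x <= log2 y.
Proof.
move=> x0 xy; rewrite ler_pM2r ?invr_gt0 ?ln2_gt0 // ler_ln ?posrE //.
exact: lt_le_trans xy.
Qed.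

Lemma log2M (x y : R) : 0 < x -> 0 < y -> log2 (x * y) = log2 x + log2 y.
Proof. by move=> x0 y0; rewrite /log2 lnM ?posrE // mulrDl. Qed.

Lemma log2V (x : R) : 0 < x -> log2 x^-1 = - log2 x.
Proof. by move=> x0; rewrite /log2 lnV ?posrE // mulNr. Qed.

Lemma log2X (x : R) n : 0 < x -> log2 (x ^+ n) = n%:R * log2 x.
Proof. by move=> x0; rewrite /log2 lnXn // -[X in X / _ = _]mulr_natl mulrA. Qed.

Lemma log2_2 : log2 2 = 1 :> R.
Proof. exact: divff (lt0r_neq0 ln2_gt0). Qed.

Lemma capacity_has_ub p (eps : R) (T : 'M[C]_p -> 'M[C]_p) :
  has_ubound [set log2 (m%:R : R) | m in [set m : nat | (0 < m <= p)%N /\ 1 - eps <= min_fidelity T m]].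
Proof.
exists (log2 p%:R) => _ [m [/andP[m0 mp] _] <-].
by apply: log2_le; rewrite ?ltr0n ?ler_nat.
Qed.

Lemma capacity_ge p (eps : R) (T : 'M[C]_p -> 'M[C]_p) m : (0 < m <= p)%N ->
  1 - eps <= min_fidelity T m -> log2 m%:R <= one_shot_capacity eps T.
Proof.
move=> hm hf; apply: ub_le_sup; first exact: capacity_has_ub.
by exists m.
Qed.

(** Holds even when no [m] is admissible, the supremum then being 0; this settles the case of a
    nonpositive lower bound. *)
Lemma capacity_ge0 p (eps : R) (T : 'M[C]_p -> 'M[C]_p) : 0 <= one_shot_capacity eps T.
Proof.
rewrite /one_shot_capacity; set E := (X in sup X).
have [[x Ex]|E0] := pselect (E !=set0); last by rewrite sup_out // => -[].
apply: le_trans (ub_le_sup (capacity_has_ub eps T) Ex).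
by case: Ex => m [/andP[m0 _] _] <-; apply: log2_ge0; rewrite ler1n.
Qed.

(** With y the square root, 0 <= y < 1, so 1 - y <= 1 - y^2 = x^2. The middle quantity is
    2^-g(x). *)
Lemma one_sub_sqrt_bounds (x : R) : 0 < x -> x < 1 ->
  0 < 1 - Num.sqrt (1 - x ^+ 2) <= x ^+ 2.
Proof.
move=> x0 x1; have y0 : 0 <= 1 - x ^+ 2 by nra.
have := sqr_sqrtr y0; have := sqrtr_ge0 (1 - x ^+ 2).
by move: (Num.sqrt _) => y y0' y2; apply/andP; split; nra.
Qed.

(** The bound for a single sigma_F and a single delta, multiplied by n. *)
Theorem capacity_bound K (A : 'I_K -> 'M[C]_2) (r : 'I_K -> C) (T : 'M[C]_2 -> 'M[C]_2)
    (eps x delta : R) n :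
  T =1 kraus A -> \sum_k (A k)^t* *m A k = 1%:M ->
  (forall k, 0 <= r k) -> \sum_k r k ^+ 2 = 1 -> (forall k, r k = 0 -> A k = 0) ->
  0 < eps -> eps <= 2 -> 0 < x -> 0 < delta -> x + delta = Num.sqrt (eps / 2) ->
  n%:R * - log2 (complex.Re (overlap_sum A r / 4)) - (gfun x + 4 * log2 (1 / delta) + 2)
  <= one_shot_capacity eps (@channel_pow R 2 T n).
Proof.
move=> hT hA r0 r1 hr eps0 eps2 x0 delta0 hs.
set mu := complex.Re _.
have ov2 : 2 <= overlap_sum A r by apply: overlap_sum_ge.
have ovE : overlap_sum A r = ((4 * mu)%:C)%C.
  have ovR : overlap_sum A r / 4 \is Num.real.
    by rewrite ger0_real // divr_ge0 ?ler0n // (le_trans _ ov2) // ler0n.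
  by rewrite rmorphM /= RRe_real // rmorph_nat; field.
have mu2 : 2^-1 <= mu.
  have : (2 : R) <= 4 * mu by rewrite -lecR -ovE rmorph_nat.
  by lra.
have mu0 : 0 < mu by apply: lt_le_trans mu2; rewrite invr_gt0.
have s2 : (x + delta) ^+ 2 = eps / 2.
  by rewrite hs sqr_sqrtr // divr_ge0 // ltW.
have x1 : x < 1 by nra.
have /andP[g0 gx] := one_sub_sqrt_bounds x0 x1.
(* [B] is 2 to the power of the left-hand side; the denominator 4 comes from the constant 2. *)
set B := (mu ^+ n)^-1 * (1 - Num.sqrt (1 - x ^+ 2)) * delta ^+ 4 / 4.
have mun0 : 0 < mu ^+ n by rewrite exprn_gt0.
have B0 : 0 < B by rewrite divr_gt0 // mulr_gt0 ?exprn_gt0 // mulr_gt0 // invr_gt0.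
have -> : n%:R * - log2 mu - (gfun x + 4 * log2 (1 / delta) + 2) = log2 B.
  have p1 : 0 < (mu ^+ n)^-1 by rewrite invr_gt0.
  have p3 : 0 < delta ^+ 4 by rewrite exprn_gt0.
  have p4 : 0 < 4^-1 :> R by rewrite invr_gt0.
  rewrite /B (log2M (mulr_gt0 (mulr_gt0 p1 g0) p3) p4) (log2M (mulr_gt0 p1 g0) p3).
  rewrite (log2M p1 g0) !log2V // !log2X // div1r log2V // /gfun.
  have -> : log2 4 = 2 :> R.
    by rewrite (_ : 4 = 2 ^+ 2); [rewrite log2X // log2_2 mulr1|ring].
  by ring.
have [B1|B1] := lerP B 1.
  apply: le_trans (capacity_ge0 _ _).
  by rewrite -oppr_ge0 -log2V // log2_ge0 // invf_ge1.
(* As [1 < B], rounding up costs at most a factor 2. *)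
pose m := (Num.truncn B).+1.
have /andP[mB1 mB2] := truncn_itv (ltW B0).
have Bm : B <= m%:R by apply: ltW.
have mB : m%:R <= 2 * B by rewrite /m -natr1; lra.
(* By [m <= 2 B] the left side is at most 64 (1 - sqrt (1 - x^2)) delta^4, hence at most 64 x^2
   delta^4. As (x + delta)^2 = eps / 2, AM-GM gives 8 x delta <= eps, and delta <= 1 disposes of the
   remaining delta^2. *)
have key : 128 * m%:R * mu ^+ n <= eps ^+ 2.
  have e1 : B * mu ^+ n = (1 - Num.sqrt (1 - x ^+ 2)) * delta ^+ 4 / 4.
    by rewrite /B; field; rewrite gt_eqF.
  have e2 : (1 - Num.sqrt (1 - x ^+ 2)) * delta ^+ 4 <= x ^+ 2 * delta ^+ 4.
    by rewrite ler_wpM2r // exprn_ge0 // ltW.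
  have e3 : 64 * (x ^+ 2 * delta ^+ 4) <= eps ^+ 2.
    have xd : 0 <= x * delta by rewrite mulr_ge0 // ltW.
    have h1 : 8 * (x * delta) <= eps.
      have : 0 <= (x - delta) ^+ 2 by rewrite sqr_ge0.
      by move: s2; rewrite !expr2; lra.
    have h2 : delta ^+ 2 <= 1 by nra.
    have h3 : (8 * (x * delta)) ^+ 2 <= eps ^+ 2.
      by rewrite lerXn2r // ?nnegrE ?mulr_ge0 // ltW.
    apply: le_trans h3; rewrite (_ : 64 * _ = (8 * (x * delta)) ^+ 2 * delta ^+ 2); last by ring.
    by rewrite ler_piMr // sqr_ge0.
  apply: (@le_trans _ _ (128 * (2 * B) * mu ^+ n)).
    by rewrite ler_wpM2r ?(ltW mun0) // ler_wpM2l // ler0n.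
  by rewrite (_ : 128 * (2 * B) * mu ^+ n = 256 * (B * mu ^+ n)); [rewrite e1; lra|ring].
apply: (@le_trans _ _ (log2 m%:R)); first exact: log2_le.
have dimE : (dimpow 2 n)%:R = 2 ^+ n :> R by rewrite dimpowE natrX.
apply: capacity_ge.
  rewrite /= -(ler_nat R) dimE.
  (* Since 2 mu >= 1 by [overlap_sum_ge], [key] also forces m <= 2^n, as the capacity requires. *)
  have h4 : 1 <= 2 ^+ n * mu ^+ n.
    by rewrite -exprMn exprn_ege1 //; move: mu2; lra.
  have h5 : eps ^+ 2 <= 4 by nra.
  have h6 : 128 * m%:R * mu ^+ n <= 4 * (2 ^+ n * mu ^+ n).
    by apply: (le_trans key); apply: (le_trans h5); lra.
  have h7 : 128 * m%:R <= 4 * 2 ^+ n :> R.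
    by rewrite -(ler_pM2r mun0) -[leRHS]mulrA.
  have h8 : 0 <= m%:R :> R by rewrite ler0n.
  by lra.
have [H hH hflat] := hadamard_exists R n.
have hTn := @channel_pow_kraus R K 2 A T n hT.
refine (@min_fidelity_kraus R _ _ _ _ (@weight_pow R K r n) H _ _ hTn _ _ _ _ _ _ _ _ hH hflat _) => //.
- by rewrite dimpowE expn_gt0.
- exact: kraus_pow_tp.
- by move=> k; apply: weight_pow_ge0.
- exact: weight_pow_sum.
- by move=> k; apply: kraus_pow_eq0.
(* For n uses the weighted sum is (4 mu)^n and the squared dimension is 4^n; their quotient mu^n is
   the one in [key]. *)
rewrite -/(overlap_sum _ _) overlap_sum_pow ovE.
have -> : (128 * m%:R * (((4 * mu)%:C)%C : C) ^+ n : C) =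
    ((128 * m%:R * (4 * mu) ^+ n)%:C)%C.
  by rewrite [in RHS]rmorphM [in RHS]rmorphM rmorphXn !rmorph_nat.
have -> : ((eps%:C)%C : C) ^+ 2 * (dimpow 2 n)%:R ^+ 2 = ((eps ^+ 2 * (2 ^+ n) ^+ 2)%:C)%C.
  by rewrite rmorphM !rmorphXn !rmorph_nat dimpowE natrX.
rewrite lecR.
rewrite -exprM mulnC exprM exprMn.
have -> : (2 ^+ 2 : R) = 4 by ring.
by rewrite [4 ^+ n * _]mulrC mulrA ler_wpM2r ?exprn_ge0 ?ler0n.
Qed.

End Capacity.

(** * The optimal delta *)

Section Argmin.
Variable R : realType.

(** 2 to the power of minus the function to be minimized. Unlike its logarithm it extends
    continuously to both ends of the interval. *)
Definition penalty (s delta : R) : R :=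
  (1 - Num.sqrt (1 - (s - delta) ^+ 2)) * delta ^+ 4.

Lemma penalty_gt0 (s delta : R) : s <= 1 -> 0 < delta < s -> 0 < penalty s delta.
Proof.
move=> s1 /andP[d0 ds].
have x0 : 0 < s - delta by rewrite subr_gt0.
have x1 : s - delta < 1 by lra.
have /andP[g0 _] := one_sub_sqrt_bounds x0 x1.
by rewrite mulr_gt0 // exprn_gt0.
Qed.

Lemma penalty_log2 (s delta : R) : s <= 1 -> 0 < delta < s ->
  gfun (s - delta) - 4 * log2 delta = - log2 (penalty s delta).
Proof.
move=> s1 /andP[d0 ds].
have x0 : 0 < s - delta by rewrite subr_gt0.
have x1 : s - delta < 1 by lra.
have /andP[g0 _] := one_sub_sqrt_bounds x0 x1.
by rewrite /penalty log2M ?exprn_gt0 // log2X // /gfun opprD.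
Qed.

Lemma log2_lt (x y : R) : 0 < x -> x < y -> log2 x < log2 y.
Proof.
move=> x0 xy; rewrite ltr_pM2r ?invr_gt0 ?ln2_gt0 // ltr_ln ?posrE //.
exact: lt_trans xy.
Qed.

(** The maximum over the closed interval is interior, because [penalty] vanishes at 0 and at [s] and
    is positive between. *)
Lemma penalty_max (s : R) : 0 < s -> s <= 1 ->
  exists2 c, 0 < c < s & forall d, 0 < d < s -> penalty s d <= penalty s c.
Proof.
move=> s0 s1.
have cont : {within `[0, s], continuous (penalty s)}.
  apply: continuous_subspaceT => x.
  apply: cvgM; last exact: exprn_continuous.
  apply: cvgB; first exact: cvg_cst.
  have c1 : {for x, continuous (fun d : R => s - d)}.
    by apply: cvgB; [exact: cvg_cst|exact: cvg_id].
  have c2 : {for x, continuous ((fun y : R => y ^+ 2) \o (fun d : R => s - d))}.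
    by apply: continuous_comp; [exact: c1|exact: exprn_continuous].
  have c3 : {for x, continuous (fun d : R => 1 - (s - d) ^+ 2)}.
    by apply: cvgB; [exact: cvg_cst|exact: c2].
  have c4 : {for x, continuous (Num.sqrt \o (fun d : R => 1 - (s - d) ^+ 2))}.
    by apply: continuous_comp; [exact: c3|exact: sqrt_continuous].
  exact: c4.
have [c cs cmax] := EVT_max (ltW s0) cont.
move: cs; rewrite in_itv /= => /andP[c0 cs].
have hmid : 0 < penalty s (s / 2) by apply: penalty_gt0 => //; lra.
have hc : 0 < penalty s c.
  by apply: lt_le_trans hmid _; apply: cmax; rewrite in_itv /=; lra.
exists c.
  apply/andP; split; rewrite lt_neqAle ?c0 ?cs andbT.
    by apply: contraTneq hc => <-; rewrite /penalty expr0n /= mulr0 ltxx.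
  apply: contraTneq hc => ->.
  by rewrite /penalty subrr expr0n /= subr0 sqrtr1 subrr mul0r ltxx.
move=> d /andP[d0 ds]; apply: cmax; rewrite in_itv /=; lra.
Qed.

(* The sine and cosine of t/2, for x = sin t. *)
Lemma half_angle (x : R) : 0 < x -> x < 1 -> exists u, exists v,
    [/\ 0 < u, u < v, u ^+ 2 + v ^+ 2 = 1, x = 2 * (u * v) &
        Num.sqrt (1 - x ^+ 2) = 1 - 2 * u ^+ 2].
Proof.
move=> xp xl; have y0 : 0 <= 1 - x ^+ 2 by nra.
have y2 := sqr_sqrtr y0; have yp := sqrtr_ge0 (1 - x ^+ 2).
have yp' : 0 < Num.sqrt (1 - x ^+ 2) by rewrite sqrtr_gt0; nra.
move: (Num.sqrt _) yp yp' y2 => y yp yp' y2.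
have y1 : y < 1 by nra.
have hu : 0 <= (1 - y) / 2 by lra.
have hv : 0 <= (1 + y) / 2 by lra.
have u2 := sqr_sqrtr hu; have v2 := sqr_sqrtr hv.
have u0 : 0 < Num.sqrt ((1 - y) / 2) by rewrite sqrtr_gt0; lra.
have v0 : 0 < Num.sqrt ((1 + y) / 2) by rewrite sqrtr_gt0; lra.
exists (Num.sqrt ((1 - y) / 2)), (Num.sqrt ((1 + y) / 2)).
move: (Num.sqrt ((1 - y) / 2)) (Num.sqrt ((1 + y) / 2)) u0 v0 u2 v2 => u v u0 v0 u2 v2.
split => //; [by nra|by lra| |by lra].
have : x ^+ 2 = (2 * (u * v)) ^+ 2.
  rewrite exprMn [(u * v) ^+ 2]exprMn u2 v2; lra.
move=> /eqP; rewrite eqrXn2 // ?(ltW xp) // => [/eqP //|].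
by rewrite !mulr_ge0 // ltW.
Qed.

(* With x = sin t, the penalty is strictly log-concave in t; the point [xm] is
   the sine of the mean angle, written with half-angle coordinates. *)
Lemma penalty_midpoint (s d1 d2 : R) : s <= 1 -> 0 < d1 < s -> 0 < d2 < s -> d1 < d2 ->
  exists2 d, 0 < d < s & penalty s d1 * penalty s d2 < penalty s d ^+ 2.
Proof.
move=> s1 /andP[p1 q1] /andP[p2 q2] d12.
pose x1 := s - d1; pose x2 := s - d2.
have x1p : 0 < x1 by rewrite subr_gt0.
have x2p : 0 < x2 by rewrite subr_gt0.
have x11 : x1 < 1 by rewrite /x1; lra.
have x21 : x2 < 1 by rewrite /x2; lra.
have x21' : x2 < x1 by rewrite /x1 /x2; lra.
have [u1 [v1 [u1p uv1 n1 e1 sq1]]] := half_angle x1p x11.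
have [u2 [v2 [u2p uv2 n2 e2 sq2]]] := half_angle x2p x21.
have v1p : 0 < v1 by lra.
have v2p : 0 < v2 by lra.
(* 2 u v with u^2 + v^2 = 1 increases with u as long as u < v, that is, for half-angles below
   pi/4. *)
have u21 : u2 < u1.
  rewrite ltNge; apply/negP => le12.
  have : v2 <= v1 by nra.
  move=> le21.
  have h3 : u1 ^+ 2 <= u2 ^+ 2 by nra.
  have w1 : v1 ^+ 2 = 1 - u1 ^+ 2 by lra.
  have w2 : v2 ^+ 2 = 1 - u2 ^+ 2 by lra.
  have h4 : x1 ^+ 2 <= x2 ^+ 2.
    have -> : x1 ^+ 2 = 4 * (u1 ^+ 2 * (1 - u1 ^+ 2)) by rewrite -w1 e1; ring.
    have -> : x2 ^+ 2 = 4 * (u2 ^+ 2 * (1 - u2 ^+ 2)) by rewrite -w2 e2; ring.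
    by nra.
  by nra.
(* With x_i = sin t_i, [xm] is sin ((t1 + t2) / 2) and [k] is cos ((t1 - t2) / 2); [k < 1] is the
   source of strictness. *)
pose xm := u1 * v2 + u2 * v1; pose k := u1 * u2 + v1 * v2.
have k1 : k < 1.
  have : 0 < (u1 - u2) ^+ 2 by rewrite exprn_gt0 // subr_gt0.
  have : 0 <= (v1 - v2) ^+ 2 by rewrite sqr_ge0.
  by rewrite /k; lra.
have xmk : xm <= k by rewrite /xm /k; nra.
have xm0 : 0 < xm by rewrite /xm addr_gt0 // mulr_gt0.
have v12 : v1 < v2 by nra.
have xms : xm < s.
  suff : xm <= x1 by rewrite /x1; lra.
  rewrite e1 /xm.
  suff : u1 * (v2 - v1) <= v1 * (u1 - u2) by lra.
  have h5 : (v2 - v1) * (v2 + v1) = (u1 - u2) * (u1 + u2) by lra.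
  rewrite -(ler_pM2r (_ : 0 < v2 + v1)); last by rewrite addr_gt0.
  have -> : u1 * (v2 - v1) * (v2 + v1) = (u1 - u2) * (u1 * (u1 + u2)) by rewrite -mulrA h5; ring.
  have -> : v1 * (u1 - u2) * (v2 + v1) = (u1 - u2) * (v1 * (v2 + v1)) by ring.
  rewrite ler_wpM2l ?subr_ge0 ?(ltW u21) //.
  by apply: ler_pM; rewrite ?addr_ge0 ?ltW //; lra.
have sqm : Num.sqrt (1 - xm ^+ 2) = v1 * v2 - u1 * u2.
  have -> : 1 - xm ^+ 2 = (v1 * v2 - u1 * u2) ^+ 2.
    have -> : (1 : R) = (u1 ^+ 2 + v1 ^+ 2) * (u2 ^+ 2 + v2 ^+ 2) by rewrite n1 n2 mulr1.
    by rewrite /xm; ring.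
  by rewrite sqrtr_sqr ger0_norm //; nra.
exists (s - xm); first by rewrite subr_gt0 xms /=; lra.
rewrite /penalty subKr sqm -/x1 -/x2 sq1 sq2.
(* Midpoint log-concavity of s - sin t. From x1 + x2 = 2 xm k and x1 x2 = xm^2 + k^2 - 1, the
   difference of the two sides factors as (1 - k) (1 + k - 2 s xm), where s xm <= xm <= k. *)
have hB : d1 * d2 <= (s - xm) ^+ 2.
  have -> : d1 = s - x1 by rewrite /x1; lra.
  have -> : d2 = s - x2 by rewrite /x2; lra.
  rewrite -subr_ge0.
  have i1 : x1 + x2 = 2 * (xm * k).
    have -> : x1 + x2 = 2 * (u1 * v1 * (u2 ^+ 2 + v2 ^+ 2) + u2 * v2 * (u1 ^+ 2 + v1 ^+ 2)).
      by rewrite n1 n2 e1 e2; ring.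
    by rewrite /xm /k; ring.
  have i2 : x1 * x2 = xm ^+ 2 + k ^+ 2 - 1.
    have -> : xm ^+ 2 + k ^+ 2 - 1 =
       (u1 ^+ 2 + v1 ^+ 2) * (u2 ^+ 2 + v2 ^+ 2) + 4 * (u1 * v1 * u2 * v2) - 1.
      by rewrite /xm /k; ring.
    by rewrite n1 n2 e1 e2; ring.
  have -> : (s - xm) ^+ 2 - (s - x1) * (s - x2) = (1 - k) * (1 + k - 2 * (s * xm)).
    have -> : (s - x1) * (s - x2) = s ^+ 2 - s * (x1 + x2) + x1 * x2 by ring.
    by rewrite i1 i2; ring.
  apply: mulr_ge0; first by lra.
  have : s * xm <= xm by rewrite ler_piMl // ltW.
  lra.
(* Strict midpoint log-concavity of 1 - cos t = 2 sin^2 (t/2); after taking roots it is the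
   inequality [k < 1]. *)
have hA : (1 - (1 - 2 * u1 ^+ 2)) * (1 - (1 - 2 * u2 ^+ 2)) < (1 - (v1 * v2 - u1 * u2)) ^+ 2.
  have -> : (1 - (1 - 2 * u1 ^+ 2)) * (1 - (1 - 2 * u2 ^+ 2)) = (2 * (u1 * u2)) ^+ 2 by ring.
  have h6 : 0 < u1 * u2 by rewrite mulr_gt0.
  by rewrite ltrXn2r // ?nnegrE /=; move: k1; rewrite /k; lra.
rewrite mulrACA -[d1 ^+ 4 * _]exprMn [ltRHS]exprMn [(_ ^+ 4) ^+ 2]exprAC.
have dd : 0 < d1 * d2 by rewrite mulr_gt0.
apply: (@lt_le_trans _ _ ((1 - (v1 * v2 - u1 * u2)) ^+ 2 * (d1 * d2) ^+ 4)).
  by rewrite ltr_pM2r // exprn_gt0.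
rewrite ler_wpM2l ?sqr_ge0 // lerXn2r // ?nnegrE ?sqr_ge0 // ltW //.
Qed.

(** Minimizers are the maximizers of [penalty]; between two distinct ones [penalty_midpoint] would
    produce a larger value. *)
Lemma argmin_exists_unique (s : R) : 0 < s -> s <= 1 ->
  exists d, unique (is_argmin_on [set delta : R | 0 < delta < s]
    (fun delta => gfun (s - delta) - 4 * log2 delta)) d.
Proof.
move=> s0 s1; have [c cI cmax] := penalty_max s0 s1.
have cmin y : 0 < y < s ->
    gfun (s - c) - 4 * log2 c <= gfun (s - y) - 4 * log2 y.
  move=> yI; rewrite !penalty_log2 // lerN2 log2_le ?penalty_gt0 //.
  exact: cmax.
have pen_eq y : is_argmin_on [set delta : R | 0 < delta < s]
    (fun delta => gfun (s - delta) - 4 * log2 delta) y -> penalty s y = penalty s c.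
  move=> [yI ymin]; apply/eqP; rewrite eq_le cmax //= leNgt; apply/negP => hlt.
  have := ymin c cI; rewrite !penalty_log2 // lerN2 leNgt log2_lt //.
  exact: penalty_gt0.
exists c; split; first by split.
move=> y hy; have py := pen_eq y hy; have [yI _] := hy.
apply/eqP; apply: contraT => ncy.
have [d dI] : exists2 d, 0 < d < s & penalty s c * penalty s y < penalty s d ^+ 2.
  move: ncy; rewrite neq_lt => /orP[lt_cy|lt_yc]; first exact: penalty_midpoint.
  by rewrite mulrC; apply: penalty_midpoint.
rewrite py -expr2 => hlt; have hle := cmax d dI.
have pd := ltW (penalty_gt0 s1 dI); have pc := ltW (penalty_gt0 s1 cI).
by move: hlt; rewrite ltNge lerXn2r.
Qed.

End Argmin.

Theorem mainTheorem1 (R : realType) (ax ay az : R)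
    (hx : ax <= pi / 2) (hxy : ay <= ax) (hyz : az <= ay) (hz : 0 <= az)
    (phi : 'M[R[i]]_2) (hphi : pure_state phi)
    (Phi : 'M[R[i]]_(2 * 2)) (hPhi : max_entangled Phi)
    (eps : R) (heps0 : 0 < eps) (heps2 : eps <= 2)
    (n : nat) (hn : (0 < n)%N) :
  let U := Ualpha ax ay az in
  let rho := rhoBF U phi Phi in
  let s := Num.sqrt (eps / 2) in
  let Qn := n%:R^-1 * one_shot_capacity eps (@channel_pow R 2 (Nchan U phi) n) in
  let I : set R := [set delta : R | 0 < delta < s] in
  let bound (delta : R) : \bar R :=
    (H2 rho - (n%:R^-1 * (gfun (s - delta) + 4 * log2 (1 / delta) + 2))%:E)%E in
  (ereal_sup [set bound delta | delta in I] <= Qn%:E)%E /\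
  exists delta_star : R,
    unique (is_argmin_on I (fun delta => gfun (s - delta) - 4 * log2 delta))
      delta_star /\
    ereal_sup [set bound delta | delta in I] = bound delta_star.
Proof.
move=> U rho s Qn I bound.
have s0 : 0 < s by rewrite sqrtr_gt0 divr_gt0.
(* This is where [eps <= 2] enters: it keeps [s - delta] in (0, 1), where the square root in [gfun]
   is genuine. *)
have s1 : s <= 1.
  rewrite -[leRHS]sqrtr1 ler_sqrt ?ler01 // ler_pdivrMr ?ltr0n // mul1r //.
have nR : 0 < n%:R :> R by rewrite ltr0n.
have bound_le delta : I delta -> (bound delta <= Qn%:E)%E.
  move=> /andP[d0 ds]; rewrite /bound leeBlDr // /H2.
  apply: ge_ereal_sup => _ [sigma hsigma <-].
  (* Without inclusion of supports D_2 is +oo, so this [sigma] contributes -oo to the supremum. *)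
  have [hsupp|/negP nsupp] := boolP (rho <= (1%:M : 'M[R[i]]_2) *t sigma)%MS; last first.
    by rewrite /D2 ifF ?leNye //; apply/negP.
  have [v hv ephi] := hphi.
  have hU : mulmx (map_mx Num.conj U^T) U = 1%:M by apply: Ualpha_unitary.
  move: hsupp; rewrite /rho ephi => hsupp.
  have [A [r [hT hA [r0 r1 hr] ->]]] := renyi_kraus hU hv hPhi hsigma hsupp.
  rewrite -EFinN -EFinD lee_fin.
  have hx0 : 0 < s - delta by rewrite subr_gt0.
  have hxs : s - delta + delta = Num.sqrt (eps / 2) by rewrite subrK.
  have := capacity_bound n hT hA r0 r1 hr heps0 heps2 hx0 d0 hxs.
  set cap := one_shot_capacity _ _; set L := log2 (complex.Re _) => hcap.
  rewrite /Qn ephi -/cap -mulrDr ler_pdivlMl //.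
  by move: hcap; lra.
split; first by apply: ge_ereal_sup => _ [delta hd <-]; apply: bound_le.
have [c hc] := argmin_exists_unique s0 s1.
exists c; split => //; have [[cI cmin] _] := hc.
(* Since log2 (1 / delta) = - log2 delta, minimizing the objective minimizes the subtracted term, so
   [bound] is maximal at [c] and the supremum is attained. *)
apply/eqP; rewrite eq_le; apply/andP; split; last by apply: ereal_sup_ubound; exists c.
apply: ge_ereal_sup => _ [delta hd <-]; apply: leeB => //.
rewrite lee_fin ler_pM2l ?invr_gt0 // lerD2r !div1r.
have [d0 _] := andP hd; have [c0 _] := andP cI.
by rewrite !log2V //; have := cmin _ hd; lra.
Qed.
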